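(* There exist positive numerical constants $c,c',c''$ such that the following holds. Let $X=(\mathbf{x}_1,\ldots,\mathbf{x}_n)\in\mathbb{R}^{d\times n}$, let $A=\frac1n XX^\top=\frac1n\sum_{i=1}^n \mathbf{x}_i\mathbf{x}_i^\top$, and let $V_k$ be the $d\times k$ matrix whose columns are (orthonormal) eigenvectors of $A$ corresponding to its $k$ largest eigenvalues. Let $\tilde W_0$ be a $d\times k$ matrix with orthonormal columns. Suppose that (i) $\max_i\|\mathbf{x}_i\|^2\le r$ for some $r>0$; (ii) $A$ has eigenvalues $s_1>s_2\ge\ldots\ge s_d$, where $s_k-s_{k+1}=\lambda$ for some $\lambda>0$; (iii) $k-\|V_k^\top\tilde W_0\|_F^2\le\frac12$. Let $\delta,\epsilon\in(0,1)$ be fixed. Suppose block VR-PCA (defined in the context) is run from $\tilde W_0$ with any epoch length $m$ and step size $\eta>0$ such that $$\eta\le\frac{c\delta^2}{r^2}\lambda,\qquad m\ge\frac{c'\log(2/\delta)}{\eta\lambda},\qquad km\eta^2r^2+rk\sqrt{m\eta^2\log(2/\delta)}\le c'',$$ for $T=\left\lceil\frac{\log(1/\epsilon)}{\log(2/\delta)}\right\rceil$ epochs. Then with probability at least $1-\lceil\log_2(1/\epsilon)\rceil\delta$, $$k-\|V_k^\top\tilde W_T\|_F^2\le\epsilon .$$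
   Context: $\|\cdot\|_F$ is the Frobenius norm; $\log$ is the natural logarithm. Block VR-PCA. Parameters: rank $k$, step size $\eta$, epoch length $m$ (a positive integer). Input: $X=(\mathbf{x}_1,\ldots,\mathbf{x}_n)\in\mathbb{R}^{d\times n}$ and a $d\times k$ matrix $\tilde W_0$ with orthonormal columns. For each epoch $s=1,2,\ldots$: - set $\tilde U=\frac1n\sum_{i=1}^n\mathbf{x}_i(\mathbf{x}_i^\top\tilde W_{s-1})$ and $W_0=\tilde W_{s-1}$; - for $t=1,\ldots,m$: let $B_{t-1}=VU^\top$, where $USV^\top$ is a singular value decomposition of the $k\times k$ matrix $W_{t-1}^\top\tilde W_{s-1}$ (equivalently, $B_{t-1}$ minimizes $\|W_{t-1}-\tilde W_{s-1}B\|_F^2$ over $k\times k$ matrices $B$ with $B^\top B=I$); draw $i_t\in\{1,\ldots,n\}$ uniformly at random, independently of everything before; set $$W'_t=W_{t-1}+\eta\left(\mathbf{x}_{i_t}\left(\mathbf{x}_{i_t}^\top W_{t-1}-\mathbf{x}_{i_t}^\top\tilde W_{s-1}B_{t-1}\right)+\tilde U B_{t-1}\right),\qquad W_t=W'_t\left(W_t'^\top W'_t\right)^{-1/2};$$ - set $\tilde W_s=W_m$. (For the step sizes considered, $W_t'^\top W_t'$ is always invertible.) The probability is over the random draws of the indices. *)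

(* Defs.v *)
From mathcomp Require Import all_boot all_order all_algebra.
From mathcomp Require Import boolp classical_sets reals topology normedtype exp.
Set Implicit Arguments.
Unset Strict Implicit.
Unset Printing Implicit Defensive.
Import Order.TTheory GRing.Theory Num.Theory.
Local Open Scope ring_scope.

Section Defs.
Variable R : realType.

Definition frobenius p q (M : 'M[R]_(p, q)) : R :=
  Num.sqrt (\sum_i \sum_j M i j ^+ 2).

(* Eigenvalues with multiplicity in nonincreasing order, indexed from 0:
   [s i] is s_(i+1), and the values [s i] with [d <= i] are irrelevant. *)
Definition ordered_eigenvalues d (A : 'M[R]_d) (s : nat -> R) : Prop :=
  char_poly A = \prod_(i < d) ('X - (s i)%:P) /\
  (forall i j : nat, (i <= j < d)%N -> s j <= s i).

Definition leading_eigenvectors d k (A : 'M[R]_d) (s : nat -> R)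
    (V : 'M[R]_(d, k)) : Prop :=
  V^T *m V = 1%:M /\ (forall j : 'I_k, A *m col j V = s j *: col j V).

Definition sym_posdef k (N : 'M[R]_k) : Prop :=
  N^T = N /\ (forall v : 'cV[R]_k, v != 0 -> 0 < (v^T *m N *m v) 0 0).

(* M^(-1/2): the positive definite square root of the inverse of M. It exists
   and is unique when M is symmetric positive definite; for singular M the
   value is the junk 0. *)
Definition invsqrtmx k (M : 'M[R]_k) : 'M[R]_k :=
  xget 0 (fun N : 'M[R]_k => sym_posdef N /\ N *m N = invmx M).

Definition is_svd k (M U : 'M[R]_k) (S : 'rV[R]_k) (V : 'M[R]_k) : Prop :=
  [/\ U^T *m U = 1%:M, V^T *m V = 1%:M, forall j, 0 <= S 0 j
    & M = U *m diag_mx S *m V^T].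

Definition svd_rotation k (M B : 'M[R]_k) : Prop :=
  exists U S V, is_svd M U S V /\ B = V *m U^T.

Definition sample_cov d n (X : 'M[R]_(d, n)) : 'M[R]_d :=
  n%:R^-1 *: (X *m X^T).

Section BlockVRPCA.
Variables (d n k : nat) (X : 'M[R]_(d, n)) (eta : R).

(* The matrix V U^T need not be unique when W_(t-1)^T W~_(s-1) is singular.
   [rot h M] is the one picked for M after the draws h (all the indices drawn
   so far, oldest first, all epochs included). *)
Variable rot : seq 'I_n -> 'M[R]_k -> 'M[R]_k.

Definition full_grad (Wt : 'M[R]_(d, k)) : 'M[R]_(d, k) :=
  n%:R^-1 *: \sum_(i < n) col i X *m ((col i X)^T *m Wt).

Definition vrpca_step (Wt : 'M[R]_(d, k)) (B : 'M[R]_k) (i : 'I_n)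
    (W : 'M[R]_(d, k)) : 'M[R]_(d, k) :=
  let x := col i X in
  let W' := W + eta *: (x *m (x^T *m W - x^T *m Wt *m B)
                        + full_grad Wt *m B) in
  W' *m invsqrtmx (W'^T *m W').

Fixpoint vrpca_inner (Wt : 'M[R]_(d, k)) (h : seq 'I_n) (W : 'M[R]_(d, k))
    (draws : seq 'I_n) : 'M[R]_(d, k) :=
  if draws is i :: draws' then
    vrpca_inner Wt (rcons h i) (vrpca_step Wt (rot h (W^T *m Wt)) i W) draws'
  else W.

Definition vrpca_epoch (h : seq 'I_n) (Wt : 'M[R]_(d, k)) (draws : seq 'I_n) :=
  vrpca_inner Wt h Wt draws.

(* [w] lists the draws of the successive epochs, m for each of the T epochs. *)
Fixpoint vrpca_from m (h : seq 'I_n) (Wt : 'M[R]_(d, k))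
    (w : seq (m.-tuple 'I_n)) : 'M[R]_(d, k) :=
  if w is e :: w' then vrpca_from (h ++ e) (vrpca_epoch h Wt e) w' else Wt.

Definition vrpca m T (W0 : 'M[R]_(d, k)) (w : T.-tuple (m.-tuple 'I_n)) :=
  vrpca_from [::] W0 w.

End BlockVRPCA.

(* Under the uniform law on T.-tuple (m.-tuple 'I_n) the T * m coordinates are
   independent and uniform on 'I_n. *)
Definition uniform_prob (Omega : finType) (E : pred Omega) : R :=
  #|E|%:R / #|Omega|%:R.

End Defs.

(* Main.v *)
(** With [V = Vk], measure a [d * k] matrix [W] with orthonormal columns by
    [F(W) = k - |V^T W|^2 = min_Z |V - W Z|^2]. The normalization of an iterate
    [W' = W + eta (A W + N)] only changes the basis of its column space, so
    [F] at the next iterate is at most [|V - W' Z|^2] for every [Z]. Choosing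
    [Z = (1 + eta W^T A W)^-1 W^T V] makes the first-order part explicit and
    gives, as long as [F(W) <= 3/4],
    [F(W+) <= (1 - eta lambda / 4) F(W) + O(eta^2 r^2) F(W~) + xi], where [xi]
    is linear in the noise [N], has mean zero, and is [O(eta r)]. The term
    [F(W~)] appears because the rotation [B] aligns [W~] with [W] well enough
    that [|W - W~ B|^2 <= 4 (F(W) + F(W~))].

    The iterates leave the region [F <= 3/4] within an epoch with probability
    at most [delta / 2], by an exponential supermartingale; otherwise [F]
    contracts in mean, and Markov's inequality shows that an epoch multiplies
    the bound on [F] by [delta / 2] with failure probability [delta]. A union
    bound over the epochs concludes. *)

Require Import Defs.
From mathcomp Require Import all_boot all_order all_algebra.
From mathcomp Require Import boolp classical_sets reals topology normedtype exp.
From mathcomp Require Import sequences ring lra.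
From mathcomp Require complex.
Set Implicit Arguments.
Unset Strict Implicit.
Unset Printing Implicit Defensive.
Import Order.TTheory GRing.Theory Num.Theory.
Local Open Scope ring_scope.

(** * The Frobenius inner product *)

Section FrobeniusProduct.
Variable R : realFieldType.

Definition fdot p q (A B : 'M[R]_(p, q)) : R := \tr (A^T *m B).
Definition fsq p q (A : 'M[R]_(p, q)) : R := fdot A A.

Lemma fdotE p q (A B : 'M[R]_(p, q)) :
  fdot A B = \sum_i \sum_j A i j * B i j.
Proof.
rewrite exchange_big; apply: eq_bigr => j _; rewrite !mxE.
by apply: eq_bigr => i _; rewrite !mxE.
Qed.

Lemma fdotC p q (A B : 'M[R]_(p, q)) : fdot A B = fdot B A.
Proof. by rewrite /fdot -mxtrace_tr trmx_mul trmxK. Qed.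

Lemma fdotDl p q (A B C : 'M[R]_(p, q)) : fdot (A + B) C = fdot A C + fdot B C.
Proof. by rewrite /fdot linearD mulmxDl linearD. Qed.

Lemma fdotDr p q (A B C : 'M[R]_(p, q)) : fdot A (B + C) = fdot A B + fdot A C.
Proof. by rewrite fdotC fdotDl !(fdotC A). Qed.

Lemma fdotNl p q (A B : 'M[R]_(p, q)) : fdot (- A) B = - fdot A B.
Proof. by rewrite /fdot linearN mulNmx linearN. Qed.

Lemma fdotNr p q (A B : 'M[R]_(p, q)) : fdot A (- B) = - fdot A B.
Proof. by rewrite fdotC fdotNl fdotC. Qed.

Lemma fdotZl p q a (A B : 'M[R]_(p, q)) : fdot (a *: A) B = a * fdot A B.
Proof. by rewrite /fdot linearZ -scalemxAl linearZ. Qed.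

Lemma fdotZr p q a (A B : 'M[R]_(p, q)) : fdot A (a *: B) = a * fdot A B.
Proof. by rewrite fdotC fdotZl fdotC. Qed.

Lemma fdot0r p q (A : 'M[R]_(p, q)) : fdot A 0 = 0.
Proof. by rewrite /fdot mulmx0 linear0. Qed.

Lemma fdot_mulmxl p q s (A : 'M[R]_(p, q)) (B : 'M_(p, s)) (C : 'M_(s, q)) :
  fdot A (B *m C) = fdot (B^T *m A) C.
Proof. by rewrite /fdot trmx_mul trmxK mulmxA. Qed.

Lemma fdot_mulmxr p q s (A : 'M[R]_(p, q)) (B : 'M_(p, s)) (C : 'M_(s, q)) :
  fdot A (B *m C) = fdot (A *m C^T) B.
Proof. by rewrite /fdot trmx_mul trmxK mulmxA mxtrace_mulC mulmxA. Qed.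

Lemma fsqE p q (A : 'M[R]_(p, q)) : fsq A = \sum_i \sum_j A i j ^+ 2.
Proof. by rewrite /fsq fdotE; do 2![apply: eq_bigr => ? _]; rewrite expr2. Qed.

Lemma fsq_ge0 p q (A : 'M[R]_(p, q)) : 0 <= fsq A.
Proof. by rewrite fsqE; do 2![apply: sumr_ge0 => ? _]; exact: sqr_ge0. Qed.

Lemma fsq_eq0 p q (A : 'M[R]_(p, q)) : (fsq A == 0) = (A == 0).
Proof.
apply/eqP/eqP => [|->]; last by rewrite /fsq fdot0r.
rewrite fsqE => /psumr_eq0P A0; apply/matrixP => i j; rewrite mxE.
have /psumr_eq0P -/(_ _ j isT) : \sum_j A i j ^+ 2 = 0.
  by apply: A0 => // l _; apply: sumr_ge0 => ? _; exact: sqr_ge0.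
by move=> /(_ (fun l _ => sqr_ge0 (A i l)))/eqP; rewrite sqrf_eq0 => /eqP.
Qed.

Lemma fsq_gt0 p q (A : 'M[R]_(p, q)) : (0 < fsq A) = (A != 0).
Proof. by rewrite lt0r fsq_ge0 andbT fsq_eq0. Qed.

Lemma fsqD p q (A B : 'M[R]_(p, q)) :
  fsq (A + B) = fsq A + 2 * fdot A B + fsq B.
Proof. by rewrite /fsq fdotDl !fdotDr (fdotC B A); ring. Qed.

Lemma fsqN p q (A : 'M[R]_(p, q)) : fsq (- A) = fsq A.
Proof. by rewrite /fsq fdotNl fdotNr opprK. Qed.

Lemma fsqB p q (A B : 'M[R]_(p, q)) :
  fsq (A - B) = fsq A - 2 * fdot A B + fsq B.
Proof. by rewrite fsqD fsqN fdotNr mulrN. Qed.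

Lemma fsqZ p q a (A : 'M[R]_(p, q)) : fsq (a *: A) = a ^+ 2 * fsq A.
Proof. by rewrite /fsq fdotZl fdotZr mulrA. Qed.

Lemma fsqT p q (A : 'M[R]_(p, q)) : fsq A^T = fsq A.
Proof. by rewrite /fsq /fdot trmxK mxtrace_mulC. Qed.

Lemma fsqD_le p q (A B : 'M[R]_(p, q)) : fsq (A + B) <= 2 * fsq A + 2 * fsq B.
Proof. by have := fsq_ge0 (A - B); rewrite fsqB fsqD; lra. Qed.

Lemma fsqB_le p q (A B : 'M[R]_(p, q)) : fsq (A - B) <= 2 * fsq A + 2 * fsq B.
Proof. by rewrite -(fsqN B) fsqD_le. Qed.

(** Young's inequality, from [|t A - B|^2 >= 0]. The later weights [r] and [r ^+ 2] give both terms
    the same scaling in [r]. *)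
Lemma fdot_le p q (A B : 'M[R]_(p, q)) t : 0 < t ->
  2 * fdot A B <= t * fsq A + t^-1 * fsq B.
Proof.
move=> t0; have := fsq_ge0 (t *: A - B); rewrite fsqB fsqZ fdotZl => H.
have -> : t * fsq A + t^-1 * fsq B
    = t^-1 * (t ^+ 2 * fsq A + fsq B) by field; rewrite gt_eqF.
by rewrite mulrC ler_pdivlMl //; lra.
Qed.

Lemma fdot_cauchy p q (A B : 'M[R]_(p, q)) : fdot A B ^+ 2 <= fsq A * fsq B.
Proof.
have [->|B0] := eqVneq B 0; first by rewrite /fsq !fdot0r mulr0 expr2 mulr0.
have := fsq_ge0 (fsq B *: A - fdot A B *: B).
rewrite -fsq_gt0 in B0; rewrite fsqB !fsqZ fdotZl fdotZr => H.
rewrite -subr_ge0 -(pmulr_rge0 _ B0); apply: le_trans H _.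
by rewrite le_eqVlt; apply/orP; left; apply/eqP; ring.
Qed.

(** Cauchy-Schwarz for each entry of the product, a row of [A] against a column of [B]. *)
Lemma fsqM p q s (A : 'M[R]_(p, q)) (B : 'M_(q, s)) :
  fsq (A *m B) <= fsq A * fsq B.
Proof.
have EA : fsq A = \sum_i fsq (row i A)^T.
  rewrite fsqE; apply: eq_bigr => i _; rewrite fsqT fsqE big_ord1.
  by apply: eq_bigr => j _; rewrite mxE.
have EB : fsq B = \sum_j fsq (col j B).
  rewrite fsqE exchange_big; apply: eq_bigr => j _; rewrite fsqE.
  by apply: eq_bigr => i _; rewrite big_ord1 mxE.
rewrite [leLHS]fsqE EA EB mulr_suml; apply: ler_sum => i _.
rewrite mulr_sumr; apply: ler_sum => j _.
apply: le_trans (fdot_cauchy _ _); rewrite le_eqVlt; apply/orP; left.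
apply/eqP; congr (_ ^+ 2); rewrite mxE fdotE.
by apply: eq_bigr => l _; rewrite big_ord1 !mxE.
Qed.

Definition orthonormal p q (W : 'M[R]_(p, q)) := W^T *m W == 1%:M.

Lemma fsq_isoml p q s (W : 'M[R]_(p, q)) (Y : 'M_(q, s)) :
  orthonormal W -> fsq (W *m Y) = fsq Y.
Proof.
by move=> /eqP WW; rewrite /fsq fdot_mulmxl mulmxA WW mul1mx.
Qed.

Lemma fsq_isomr p q s (W : 'M[R]_(p, q)) (Y : 'M_(s, q)) :
  orthonormal W -> fsq (Y *m W^T) = fsq Y.
Proof. by move=> WW; rewrite -fsqT trmx_mul trmxK fsq_isoml // fsqT. Qed.

Lemma fsq_contrl p q s (W : 'M[R]_(p, q)) (Y : 'M_(p, s)) :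
  orthonormal W -> fsq (W^T *m Y) <= fsq Y.
Proof.
move=> WW; have := fsq_ge0 (Y - W *m (W^T *m Y)).
rewrite fsqB fsq_isoml // fdot_mulmxl /fsq; lra.
Qed.

Lemma fsq_contrr p q s (W : 'M[R]_(p, q)) (Y : 'M_(s, p)) :
  orthonormal W -> fsq (Y *m W) <= fsq Y.
Proof. by move=> WW; rewrite -fsqT trmx_mul -(fsqT Y) fsq_contrl. Qed.

Lemma fsq_orthonormal p q (W : 'M[R]_(p, q)) : orthonormal W -> fsq W = q%:R.
Proof. by move=> /eqP WW; rewrite /fsq /fdot WW mxtrace1. Qed.

Lemma fsq_residual p q s (W : 'M[R]_(p, q)) (Y : 'M_(p, s)) :
  orthonormal W -> fsq (Y - W *m (W^T *m Y)) = fsq Y - fsq (W^T *m Y).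
Proof.
by move=> WW; rewrite fsqB fsq_isoml // fdot_mulmxl /fsq; ring.
Qed.

Lemma fsq_residual_le p q s (W : 'M[R]_(p, q)) (Y : 'M_(p, s)) :
  orthonormal W -> fsq (Y - W *m (W^T *m Y)) <= fsq Y.
Proof. by move=> WW; rewrite fsq_residual // gerBl fsq_ge0. Qed.

End FrobeniusProduct.

(** * Real symmetric matrices *)

Section SpectralTheorem.
Import complex.
Variable R : rcfType.

Lemma mulmx_tr_col n (u v : 'cV[R]_n) : u^T *m v = (fdot u v)%:M.
Proof. by rewrite [LHS]mx11_scalar /fdot trace_mx11. Qed.
(** The characteristic polynomial has a complex root [a + ib]. A complex eigenvector splits as
    [x + iy] with [x], [y] real; symmetry forces [b = 0], so whichever of [x], [y] is nonzero is a
    real eigenvector. *)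
Lemma symmetric_eigenvector n (A : 'M[R]_n.+1) : A^T = A ->
  exists mu (v : 'cV[R]_n.+1), fsq v = 1 /\ A *m v = mu *: v.
Proof.
move=> Asym.
pose toC := real_complex R.
have [z] : exists z, root (char_poly (map_mx toC A)) z.
  by apply/closed_rootP; rewrite size_char_poly.
rewrite -eigenvalue_root_char => /eigenvalueP[w wA w0].
pose x := map_mx (@complex.Re R) w; pose y := map_mx (@complex.Im R) w.
case: z wA => a b wA.
have xA : x *m A = a *: x - b *: y.
  apply/rowP => j; move/rowP/(_ j)/(congr1 (@complex.Re R)): wA.
  rewrite !mxE (raddf_sum (@complex.Re R)) /= => E.
  under eq_bigr do rewrite !mxE.
  transitivity (complex.Re (((a +i* b) * w 0 j)%C)); last by case: (w 0 j).
  rewrite -E; apply: eq_bigr => l _; rewrite !mxE.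
  by case: (w 0 l) => ? ?; rewrite /= mulr0 subr0.
have yA : y *m A = a *: y + b *: x.
  apply/rowP => j; move/rowP/(_ j)/(congr1 (@complex.Im R)): wA.
  rewrite !mxE (raddf_sum (@complex.Im R)) /= => E.
  under eq_bigr do rewrite !mxE.
  transitivity (complex.Im (((a +i* b) * w 0 j)%C)); last by case: (w 0 j).
  rewrite -E; apply: eq_bigr => l _; rewrite !mxE.
  by case: (w 0 l) => ? ?; rewrite /= mulr0 add0r.
have xy0 : 0 < fsq x + fsq y.
  rewrite lt0r addr_ge0 ?fsq_ge0 // andbT; apply: contraNneq w0 => E.
  have [x_ge0 y_ge0] := (fsq_ge0 x, fsq_ge0 y).
  have x0 : x = 0 by apply/eqP; rewrite -fsq_eq0; apply/eqP; lra.
  have y0 : y = 0 by apply/eqP; rewrite -fsq_eq0; apply/eqP; lra.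
  apply/eqP/rowP => j; move/rowP/(_ j): x0; move/rowP/(_ j): y0.
  by rewrite !mxE; case: (w 0 j) => ? ? /= -> ->.
(* Computing [y A x^T = x A y^T] on both sides leaves [b (|x|^2 + |y|^2) = 0]. *)
have b0 : b = 0.
  have : fdot y (x *m A) = fdot x (y *m A).
    by rewrite fdot_mulmxr fdotC Asym.
  rewrite xA yA fdotDr fdotNr !fdotDr !fdotZr (fdotC y x) -/(fsq x) -/(fsq y).
  move=> E; apply/eqP; rewrite -(mulIr_eq0 _ (mulIf (lt0r_neq0 xy0))).
  by apply/eqP; lra.
have eigen (u : 'rV[R]_n.+1) : u *m A = a *: u -> u != 0 ->
    exists mu (v : 'cV[R]_n.+1), fsq v = 1 /\ A *m v = mu *: v.
  rewrite -fsq_gt0 => uA u0; exists a, ((Num.sqrt (fsq u))^-1 *: u^T); split.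
    by rewrite fsqZ fsqT exprVn sqr_sqrtr ?ltW // mulVf // gt_eqF.
  by rewrite -scalemxAr -{1}Asym -trmx_mul uA linearZ /= !scalerA mulrC.
have [x0|x0] := eqVneq x 0; last by apply: (eigen x); rewrite // xA b0 scale0r subr0.
apply: (eigen y); first by rewrite yA b0 scale0r addr0.
by apply: contraTneq xy0 => ->; rewrite x0 /fsq !fdot0r addr0 ltxx.
Qed.

(** The reflection [1 - 2 w w^T / |w|^2] along [w = v - u]; since [|u| = |v|], the inner product of
    [w] and [u] is [- |w|^2 / 2]. *)
Lemma householder n (u v : 'cV[R]_n) : fsq u = 1 -> fsq v = 1 ->
  exists H : 'M[R]_n, [/\ H^T = H, H *m H = 1%:M & H *m u = v].
Proof.
move=> u1 v1; have [<-|uv] := eqVneq u v.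
  by exists 1%:M; rewrite tr_scalar_mx !mul1mx.
rewrite -subr_eq0 -oppr_eq0 opprB -fsq_gt0 in uv.
pose w := v - u; pose t := 2 / fsq w.
have ww : t * fsq w = 2 by rewrite mulfVK // gt_eqF.
have wu : t * fdot w u = -1.
  have : fsq w = - 2 * fdot w u.
    by rewrite fsqB u1 v1 fdotDl fdotNl -/(fsq u) u1 /w; lra.
  move=> E; move: ww; rewrite E; lra.
exists (1%:M - t *: (w *m w^T)); split.
- by rewrite linearB linearZ /= trmx_mul trmxK tr_scalar_mx.
- rewrite mulmxBl mul1mx mulmxBr mulmx1 -scalemxAl -scalemxAr.
  rewrite -mulmxA (mulmxA w^T) mulmx_tr_col mul_scalar_mx.
  rewrite -scalemxAr -/(fsq w) [t *: (fsq w *: _)]scalerA ww.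
  by apply/matrixP => i j; rewrite !mxE; ring.
- rewrite mulmxBl mul1mx -scalemxAl -mulmxA mulmx_tr_col mul_mx_scalar.
  by rewrite scalerA wu scaleN1r opprK addrC subrK.
Qed.

(** Deflation: conjugating by a reflection that sends [e1] to a unit eigenvector splits off a block
    of size 1, and induction diagonalizes the rest. *)
Lemma symmetric_spectral n (A : 'M[R]_n) : A^T = A ->
  exists (Q : 'M[R]_n) (e : 'rV[R]_n),
    Q *m Q^T = 1%:M /\ A = Q *m diag_mx e *m Q^T.
Proof.
elim: n A => [|n IHn] A Asym.
  by exists 1%:M, 0; split; apply/matrixP => -[].
have [mu [v [v1 Av]]] := symmetric_eigenvector Asym.
pose e1 : 'cV[R]_(1 + n) := col_mx 1%:M 0.
have e11 : fsq e1 = 1.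
  rewrite /fsq /fdot tr_col_mx mul_row_col trmx0 mulmx0 addr0 tr_scalar_mx.
  by rewrite mulmx1 mxtrace1.
have [H [Hsym HH He]] := householder e11 v1.
pose B : 'M[R]_(1 + n) := H *m A *m H.
have Bsym : B^T = B by rewrite !trmx_mul Asym Hsym mulmxA.
have Be : B *m e1 = mu *: e1.
  by rewrite -[LHS]mulmxA He -mulmxA Av -scalemxAr -He mulmxA HH mul1mx.
have AE : A = H *m B *m H by rewrite !mulmxA HH mul1mx -mulmxA HH mulmx1.
have EB : B = block_mx mu%:M 0 0 (drsubmx B).
  have := Be; rewrite -{1 2}[B]submxK mul_block_col !mulmx1 !mulmx0 !addr0.
  rewrite scale_col_mx scaler0 => /eq_col_mx[ul dl].
  rewrite ul dl scalemx1; congr (block_mx _ _ _ _).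
  by rewrite -[ursubmx B]trmxK trmx_ursub Bsym dl trmx0.
have [|Q [f [QQ EQ]]] := IHn (drsubmx B).
  by rewrite trmx_drsub Bsym.
pose P : 'M[R]_(1 + n) := block_mx 1%:M 0 0 Q.
have PT : P^T = block_mx 1%:M 0 0 Q^T by rewrite tr_block_mx !trmx0 trmx1.
pose g : 'rV[R]_(1 + n) := row_mx mu%:M f.
have PP : P *m P^T = 1%:M.
  rewrite PT mulmx_block !mulmx0 !mul0mx mulmx1 QQ !addr0 add0r.
  by rewrite -scalar_mx_block.
have PgP : P *m diag_mx g *m P^T = B.
  rewrite PT diag_mx_row !mulmx_block !mulmx0 !mul0mx !mulmx1 !mul1mx.
  rewrite !addr0 !add0r ?mulmx0 ?mul0mx -EQ [RHS]EB; congr (block_mx _ _ _ _).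
  by apply/matrixP => i j; rewrite !ord1 !mxE.
exists (H *m P), g; split.
  by rewrite trmx_mul Hsym -mulmxA (mulmxA P) PP mul1mx.
by rewrite AE -PgP trmx_mul Hsym !mulmxA.
Qed.

End SpectralTheorem.

Section SpectralConsequences.
Variable R : realType.

Lemma char_poly_orthogonal n (A Q : 'M[R]_n) : Q *m Q^T = 1%:M ->
  char_poly (Q *m A *m Q^T) = char_poly A.
Proof.
move=> QQ; pose P := map_mx polyC Q; pose P' := map_mx polyC Q^T.
have PP : P *m P' = 1%:M by rewrite -map_mxM QQ map_mx1.
rewrite /char_poly; have -> : char_poly_mx (Q *m A *m Q^T)
    = P *m char_poly_mx A *m P'.
  rewrite mulmxBr mulmxBl mul_mx_scalar -scalemxAl PP scalemx1.
  by rewrite -!map_mxM.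
by rewrite !det_mulmx mulrAC -det_mulmx PP det1 mul1r.
Qed.

(** Diagonalize [M]. Its eigenvalues are the values of the quadratic form at the columns of [Q],
    hence positive; replace each by the inverse of its square root. *)
Lemma posdef_invsqrt n (M : 'M[R]_n) : sym_posdef M ->
  exists N : 'M[R]_n, sym_posdef N /\ N *m N = invmx M.
Proof.
case=> Msym Mpos; have [Q [e [QQ EM]]] := symmetric_spectral Msym.
have QQ' : Q^T *m Q = 1%:M by apply: mulmx1C.
have e_gt0 j : 0 < e 0 j.
  pose u : 'cV[R]_n := delta_mx j 0.
  have /Mpos : Q *m u != 0.
    apply/eqP => /(congr1 (mulmx Q^T)); rewrite mulmxA QQ' mul1mx mulmx0.
    by move/matrixP/(_ j 0)/eqP; rewrite !mxE !eqxx oner_eq0.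
  rewrite EM trmx_mul !mulmxA -(mulmxA _ Q^T Q) QQ' mulmx1.
  rewrite -(mulmxA _ Q^T Q) QQ' mulmx1 -mulmxA mul_diag_mx trmx_delta.
  by rewrite -rowE !mxE !eqxx mulr1.
pose f := \row_j (Num.sqrt (e 0 j))^-1.
pose N := Q *m diag_mx f *m Q^T.
exists N; split; [split|].
- by rewrite /N !trmx_mul trmxK tr_diag_mx mulmxA.
- move=> v v0; pose u := Q^T *m v.
  have u0 : u != 0.
    by apply: contraNneq v0 => u0; rewrite -[v]mul1mx -QQ -mulmxA -/u u0 mulmx0.
  have -> : v^T *m N *m v = u^T *m (diag_mx f *m u).
    by rewrite /u trmx_mul trmxK !mulmxA.
  move: u u0 => {v0} u u0; rewrite mulmx_tr_col mxE eqxx mulr1n fdotE.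
  have [i ui] : exists i, u i 0 != 0.
    apply/existsP; apply: contraNT u0 => /existsPn u0; apply/eqP/colP => i.
    by rewrite [RHS]mxE; apply/eqP/negPn/u0.
  have pos l : 0 <= u l 0 * (diag_mx f *m u) l 0.
    rewrite mul_diag_mx !mxE mulrCA -expr2 mulr_ge0 ?sqr_ge0 //.
    by rewrite invr_ge0 sqrtr_ge0.
  rewrite (bigD1 i) //= big_ord1 ltr_pwDl //.
    rewrite mul_diag_mx !mxE mulrCA -expr2 mulr_gt0 //.
      by rewrite invr_gt0 sqrtr_gt0.
    by rewrite exprn_even_gt0.
  by apply: sumr_ge0 => l _; rewrite big_ord1.
- have H : N *m N *m M = 1%:M.
    rewrite EM /N !mulmxA -(mulmxA _ Q^T Q) QQ' mulmx1.
    rewrite -(mulmxA _ Q^T Q) QQ' mulmx1 -!(mulmxA Q).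
    suff -> : diag_mx f *m diag_mx f *m diag_mx e = 1%:M by rewrite mul1mx.
    rewrite !mulmx_diag; apply/matrixP => i j; rewrite !mxE.
    case: eqP => //= _; rewrite mulr1n -invfM -expr2 sqr_sqrtr ?ltW //.
    by rewrite mulVf // gt_eqF.
  have [_ Mu] := mulmx1_unit H.
  by rewrite -[LHS](mulmxK Mu) H mul1mx.
Qed.

Section TopEigenvectors.
Variables (d k : nat) (A : 'M[R]_d) (s : nat -> R) (V : 'M[R]_(d, k)).
Hypotheses (Asym : A^T = A) (k_bounds : (0 < k < d)%N).
Hypotheses (As : ordered_eigenvalues A s) (AV : leading_eigenvectors A s V).
Hypothesis gap : s k < s k.-1.

Lemma leading_eigenvectorsE : A *m V = V *m diag_mx (\row_(j < k) s j).
Proof.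
apply/matrixP => i j; have [_ /(_ j)/colP/(_ i)] := AV.
rewrite mul_mx_diag !mxE mulrC => <-.
by apply: eq_bigr => l _; rewrite !mxE.
Qed.

(** In an eigenbasis [Q], exactly [k] eigenvalues exceed [s k], at the indices [J]. The columns of
    [Q^T V] are supported on [J] and there are [k] of them, so they span all vectors supported on
    [J]. A matrix [Y] orthogonal to [V] therefore only meets eigenvalues at most [s k]. *)
Lemma complement_eigenvalue_le p (Y : 'M[R]_(d, p)) :
  V^T *m Y = 0 -> fdot Y (A *m Y) <= s k * fsq Y.
Proof.
move=> VY; have [Q [e [QQ EA]]] := symmetric_spectral Asym.
have [VV _] := AV; have [cpA sdecr] := As.
have QQ' : Q^T *m Q = 1%:M by apply: mulmx1C.
(* Both lists are the roots of the characteristic polynomial of [A], so they agree up to order. *)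
have perm_es : perm_eq [seq e 0 j | j : 'I_d] [seq s j | j : 'I_d].
  apply: prod_XsubC_eq; rewrite !big_image /= -cpA EA char_poly_orthogonal //.
  rewrite char_poly_trig; last by exact: diag_mx_is_trig.
  by apply: eq_bigr => j _; rewrite mxE eqxx mulr1n.
pose J := [pred j | s k < e 0 j].
have cardJ : #|J| = k.
  transitivity (count (fun x => s k < x) [seq e 0 j | j : 'I_d]).
    by rewrite -sum1_count big_image_cond -sum1_card.
  have /permP -> := perm_es.
  rewrite count_map -(@count_map _ _ (@nat_of_ord d) (fun j => s k < s j)).
  rewrite val_enum_ord.
  case/andP: k_bounds => k_gt0 kd.
  rewrite -(subnKC (ltnW kd)) iotaD count_cat add0n.
  rewrite (@eq_in_count _ _ predT) ?count_predT ?size_iota; last first.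
    move=> j; rewrite mem_iota add0n /= => jk; apply: lt_le_trans gap _.
    apply: sdecr; rewrite (leq_ltn_trans (leq_pred _) kd) andbT.
    by rewrite -ltnS prednK.
  rewrite (@eq_in_count _ _ pred0) ?count_pred0 ?addn0 // => j.
  rewrite mem_iota subnKC ?(ltnW kd) // => /andP[kj jd].
  by apply/negbTE; rewrite -leNgt; apply: sdecr; rewrite kj.
pose G := Q^T *m V.
have GG : orthonormal G.
  by rewrite /orthonormal trmx_mul trmxK mulmxA -(mulmxA _ Q) QQ mulmx1 VV.
have eG : diag_mx e *m G = G *m diag_mx (\row_(j < k) s j).
  by rewrite /G -(mulmxA Q^T) -leading_eigenvectorsE EA !mulmxA QQ' mul1mx.
have G0 j i : j \notin J -> G j i = 0.
  rewrite inE -leNgt => ej; move/matrixP/(_ j i): eG.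
  rewrite mul_diag_mx mul_mx_diag !mxE => /eqP; rewrite -subr_eq0 mulrC -mulrBr.
  rewrite mulf_eq0 => /orP[/eqP //|]; rewrite subr_eq0 => /eqP E.
  have : s k.-1 <= e 0 j.
    rewrite E; apply: sdecr; case/andP: k_bounds => k_gt0 kd.
    by rewrite (leq_ltn_trans (leq_pred _) kd) andbT -ltnS prednK.
  by rewrite leNgt (le_lt_trans ej gap).
pose z := Q^T *m Y.
have Gz : G^T *m z = 0.
  by rewrite trmx_mul trmxK mulmxA -(mulmxA _ Q) QQ mulmx1.
pose u j : 'cV[R]_d := delta_mx j 0.
have u1 j : fsq (u j) = 1.
  rewrite fsqE (bigD1 j) //= big_ord1 mxE !eqxx expr1n big1 ?addr0 // => i ij.
  by rewrite big_ord1 mxE (negPf ij) expr0n.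
have uG j : fsq (G^T *m u j) = \sum_i G j i ^+ 2.
  rewrite fsqE; apply: eq_bigr => i _; rewrite big_ord1.
  by rewrite -colE !mxE.
(* Dimension count: the nonnegative defects [1 - |G^T u_j|^2] over [J] sum to [k - |G|^2 = 0]. Hence
   each such [u_j] is in the span of [G], to which [z] is orthogonal. *)
have z0 j i : j \in J -> z j i = 0.
  move=> jJ; have res : \sum_(j in J) (1 - fsq (G^T *m u j)) = 0.
    rewrite sumrB sumr_const cardJ -(fsq_orthonormal GG) fsqE.
    apply/eqP; rewrite subr_eq0; apply/eqP.
    rewrite [LHS](bigID (mem J)) /= [X in _ + X]big1 ?addr0.
      by apply: eq_bigr => l _; rewrite uG.
    by move=> l lJ; apply: big1 => q _; rewrite G0 // expr0n.
  have : 1 - fsq (G^T *m u j) = 0.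
    have pos l : l \in J -> 0 <= 1 - fsq (G^T *m u l).
      by rewrite subr_ge0 -(u1 l) fsq_contrl.
    exact: (psumr_eq0P pos res).
  rewrite -(u1 j) -fsq_residual // => /eqP; rewrite fsq_eq0 subr_eq0 => /eqP uE.
  have : row j z = 0.
    rewrite rowE -[delta_mx _ _]trmxK trmx_delta -/(u j) uE.
    by rewrite trmx_mul -(mulmxA _ G^T) Gz mulmx0.
  by move/rowP/(_ i); rewrite !mxE.
have -> : fdot Y (A *m Y) = fdot z (diag_mx e *m z).
  by rewrite EA -!mulmxA fdot_mulmxl.
have <- : fsq z = fsq Y.
  by rewrite fsq_isoml // /orthonormal trmxK QQ.
rewrite fdotE fsqE mulr_sumr; apply: ler_sum => j _.
rewrite mulr_sumr; apply: ler_sum => i _.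
have -> : (diag_mx e *m z) j i = e 0 j * z j i.
  by rewrite mul_diag_mx [LHS]mxE.
have [/z0 ->|] := boolP (j \in J); first by rewrite !mul0r expr0n mulr0.
by rewrite inE -leNgt => ej; rewrite mulrCA -expr2 ler_wpM2r // sqr_ge0.
Qed.

End TopEigenvectors.
End SpectralConsequences.

(** * Deterministic analysis of one step *)

Section Orthonormalization.
Variable R : realType.

(** Injectivity of [W'] makes its Gram matrix positive definite, so [invsqrtmx] is a genuine square
    root and not the default 0. It is invertible, so normalizing keeps the column space. *)
Lemma invsqrtmx_orthonormal d k (W' : 'M[R]_(d, k)) :
  (forall v : 'cV[R]_k, v != 0 -> W' *m v != 0) ->
  orthonormal (W' *m invsqrtmx (W'^T *m W')) /\
  exists Q, W' = W' *m invsqrtmx (W'^T *m W') *m Q.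
Proof.
move=> inj; set M := W'^T *m W'.
have Mpos : sym_posdef M.
  split=> [|v v0]; first by rewrite /M trmx_mul trmxK.
  rewrite /M -!mulmxA mulmxA -trmx_mul mulmx_tr_col mxE eqxx mulr1n.
  by rewrite -/(fsq _) fsq_gt0 inj.
have [N0 HN0] := posdef_invsqrt Mpos.
pose P (N : 'M[R]_k) := sym_posdef N /\ N *m N = invmx M.
have [[Nsym _] NN] : P (invsqrtmx M) := @xgetPex _ 0 P (ex_intro P N0 HN0).
set N := invsqrtmx M in Nsym NN *.
have Mu : M \in unitmx.
  rewrite -row_free_unit -kermx_eq0; apply/eqP/row_matrixP => i; rewrite row0.
  apply/eqP/negPn/negP; rewrite -trmx_eq0 => /(proj2 Mpos).
  by rewrite trmxK -row_mul mulmx_ker row0 mul0mx mxE ltxx.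
have Nu : N \in unitmx.
  by have := Mu; rewrite -unitmx_inv -NN unitmx_mul andbb.
split; last by exists (invmx N); rewrite mulmxK.
apply/eqP; rewrite trmx_mul Nsym mulmxA -(mulmxA N) -/M.
have -> : M = invmx N *m invmx N.
  have NNM : N *m (N *m M) = 1%:M by rewrite mulmxA NN mulVmx.
  by rewrite -[M](mulKmx Nu) -[N *m M](mulKmx Nu) NNM mulmx1.
by rewrite mulmxA mulmxV // mul1mx mulVmx.
Qed.

(** If [W v = - Y v], then [|v| = |Y v| <= |Y| |v| < |v|]. *)
Lemma injective_near_orthonormal d k (W Y : 'M[R]_(d, k)) (v : 'cV[R]_k) :
  orthonormal W -> fsq Y < 1 -> v != 0 -> (W + Y) *m v != 0.
Proof.
move=> WW Y1 v0; apply/eqP; rewrite mulmxDl => /eqP; rewrite addr_eq0 => /eqP E.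
have := fsq_isoml v WW; rewrite E fsqN => Yv.
have := fsqM Y v; rewrite Yv leNgt => /negP; apply.
by rewrite gtr_pMl // fsq_gt0.
Qed.

End Orthonormalization.

Section Descent.
Variables (R : realType) (d k : nat) (A : 'M[R]_d) (V : 'M[R]_(d, k)).
Variables (S : 'rV[R]_k) (r lambda mu : R).
Hypotheses (Asym : A^T = A) (Apsd : forall p (Y : 'M_(d, p)), 0 <= fdot Y (A *m Y)).
Hypotheses (r_gt0 : 0 < r) (Ar : fsq A <= r ^+ 2).
Hypotheses (VV : orthonormal V) (AV : A *m V = V *m diag_mx S).
Hypotheses (lambda_gt0 : 0 < lambda) (muS : forall j, mu + lambda <= S 0 j).
Hypothesis muV : forall p (Y : 'M_(d, p)), V^T *m Y = 0 ->
  fdot Y (A *m Y) <= mu * fsq Y.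

(** For orthonormal [W], the sum of the squared sines of the principal angles between the column
    spaces of [V] and [W]. *)
Definition subspace_err (W : 'M[R]_(d, k)) := k%:R - fsq (V^T *m W).

Lemma subspace_errE W : orthonormal W ->
  subspace_err W = fsq (V - W *m (W^T *m V)).
Proof.
move=> WW; rewrite fsq_residual // fsq_orthonormal // /subspace_err.
by rewrite -[in LHS]fsqT trmx_mul trmxK.
Qed.

Lemma subspace_errE' W : orthonormal W ->
  subspace_err W = fsq (W - V *m (V^T *m W)).
Proof. by move=> WW; rewrite fsq_residual // fsq_orthonormal. Qed.

Lemma subspace_err_ge0 W : orthonormal W -> 0 <= subspace_err W.
Proof. by move=> WW; rewrite subspace_errE // fsq_ge0. Qed.

(** The best choice is [Y = W^T V], and the excess is [|W^T V - Y|^2]. *)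
Lemma subspace_err_min W (Y : 'M[R]_k) : orthonormal W ->
  subspace_err W <= fsq (V - W *m Y).
Proof.
move=> WW; rewrite fsqB fdot_mulmxl fsq_isoml // fsq_orthonormal //.
have := fsq_ge0 (W^T *m V - Y); rewrite fsqB /subspace_err.
have -> : fsq (V^T *m W) = fsq (W^T *m V) by rewrite -fsqT trmx_mul trmxK.
lra.
Qed.

Section AtPoint.
Variables (W : 'M[R]_(d, k)).
Hypothesis WW : orthonormal W.

Let C := W^T *m V.
Let E := V - W *m C.
Let F := subspace_err W.
Let H := W^T *m (A *m W).
Let L := A *m W - W *m H.

Let FE : F = fsq E. Proof. exact: subspace_errE. Qed.

Let WE : W^T *m E = 0.
Proof. by rewrite mulmxBr !mulmxA (eqP WW) mul1mx subrr. Qed.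

(* The drift is [\sum_j S_j h_j - fdot Y (A *m Y)] with [Y] the part of [E]
   orthogonal to [V] and [h_j >= 0] of sum [|Y|^2]; the eigengap bounds it below
   by [lambda |Y|^2 = lambda (F - |E^T E|^2)]. *)
Lemma drift_ge : lambda * (F * (1 - F)) <= fdot E (A *m (W *m C)).
Proof.
pose G := V^T *m E; pose Y := E - V *m G.
have GE : G = E^T *m E.
  have -> : E^T = V^T - C^T *m W^T by rewrite linearB /= trmx_mul.
  by rewrite mulmxBl -mulmxA WE mulmx0 subr0.
have Gsym : G^T = G by rewrite GE trmx_mul trmxK.
have VY : V^T *m Y = 0 by rewrite mulmxBr !mulmxA (eqP VV) mul1mx subrr.
have AVG : A *m (V *m G) = V *m (diag_mx S *m G) by rewrite mulmxA AV mulmxA.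
have -> : A *m (W *m C) = V *m diag_mx S - A *m E.
  by rewrite -AV -mulmxBr /E opprB addrC subrK.
have EAE : fdot E (A *m E) = fdot G (diag_mx S *m G) + fdot Y (A *m Y).
  have EY : E = V *m G + Y by rewrite addrC subrK.
  have Y0 (M : 'M[R]_k) : fdot Y (V *m M) = 0.
    by rewrite fdot_mulmxl VY fdotC fdot0r.
  rewrite {1 2}EY mulmxDr fdotDl !fdotDr AVG Y0 add0r.
  rewrite fdot_mulmxl mulmxA (eqP VV) mul1mx.
  have -> : fdot (V *m G) (A *m Y) = 0.
    by rewrite fdot_mulmxl Asym AVG fdotC Y0.
  by rewrite addr0.
have h_ge0 j : 0 <= G j j - \sum_l G j l ^+ 2.
  have := fsq_contrl (col j E) VV; rewrite -subr_ge0; congr (0 <= _ - _).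
    rewrite GE /fsq fdotE !mxE; apply: eq_bigr => i _.
    by rewrite big_ord1 !mxE.
  have -> : V^T *m col j E = col j G by rewrite !colE mulmxA.
  rewrite fsqE; apply: eq_bigr => l _.
  by rewrite big_ord1 mxE -{1}Gsym mxE.
have Ydrift : lambda * fsq Y <= fdot E (V *m diag_mx S) - fdot E (A *m E).
  have YE : fsq Y = \sum_j (G j j - \sum_l G j l ^+ 2).
    rewrite fsq_residual // sumrB -/G (fsqE G); congr (_ - _).
    by rewrite /fsq /fdot -GE.
  have -> : fdot E (V *m diag_mx S) - fdot E (A *m E)
      = \sum_j S 0 j * (G j j - \sum_l G j l ^+ 2) - fdot Y (A *m Y).
    rewrite EAE opprD addrA; congr (_ - _); rewrite fdot_mulmxl -/G.
    rewrite !fdotE -sumrB; apply: eq_bigr => j _.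
    rewrite mulrBr; congr (_ - _).
      rewrite (bigD1 j) //= big1 ?addr0;
        first by rewrite [diag_mx S _ _]mxE eqxx mulr1n mulrC.
      by move=> l lj; rewrite [diag_mx S _ _]mxE eq_sym (negPf lj) mulr0.
    rewrite mulr_sumr; apply: eq_bigr => l _.
    have -> : (diag_mx S *m G) j l = S 0 j * G j l by rewrite mul_diag_mx [LHS]mxE.
    by ring.
  have : \sum_j (mu + lambda) * (G j j - \sum_l G j l ^+ 2)
      <= \sum_j S 0 j * (G j j - \sum_l G j l ^+ 2).
    by apply: ler_sum => j _; rewrite ler_wpM2r.
  rewrite -mulr_sumr -YE; have := muV VY; lra.
(* Here [|Y|^2 = F - |E^T E|^2], and submultiplicativity gives [|E^T E|^2 <= F ^+ 2]. *)
rewrite fdotDr fdotNr; apply: le_trans Ydrift; rewrite ler_pM2l //.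
have := fsqM E^T E; rewrite -GE fsqT -FE fsq_residual // -/G -FE; lra.
Qed.

(** Split [A W] into [V S V^T W] and [A P], where [P] is the part of [W] orthogonal to [V].
    Projecting off [W] turns the first into [E S V^T W]. Both [|E|^2] and [|P|^2] equal [F], so each
    piece is at most [r ^+ 2 * F]. *)
Lemma tangent_le : fsq L <= 4 * r ^+ 2 * F.
Proof.
pose P := W - V *m (V^T *m W).
have FP : F = fsq P by exact: subspace_errE'.
have -> : L = E *m (diag_mx S *m (V^T *m W))
    + (A *m P - W *m (W^T *m (A *m P))).
  pose X := V *m (diag_mx S *m (V^T *m W)).
  have -> : A *m P = A *m W - X by rewrite mulmxBr !mulmxA AV /X !mulmxA.
  have -> : E *m (diag_mx S *m (V^T *m W)) = X - W *m (W^T *m X).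
    by rewrite mulmxBl /X /C !mulmxA.
  by rewrite !mulmxBr opprB addrACA [X + _]addrC subrK addKr.
have SA : fsq (diag_mx S) <= r ^+ 2.
  rewrite -(fsq_isoml _ VV) -AV; exact: le_trans (fsq_contrr _ VV) Ar.
have F0 : 0 <= F by rewrite FE fsq_ge0.
have E1 : fsq (E *m (diag_mx S *m (V^T *m W))) <= F * r ^+ 2.
  rewrite !mulmxA; apply: le_trans (fsq_contrr _ WW) _.
  rewrite fsq_isomr //; apply: le_trans (fsqM _ _) _.
  by rewrite -FE ler_wpM2l.
have E2 : fsq (A *m P - W *m (W^T *m (A *m P))) <= r ^+ 2 * F.
  apply: le_trans (fsq_residual_le _ WW) _; apply: le_trans (fsqM _ _) _.
  by rewrite -FP ler_wpM2r.
have := fsqD_le (E *m (diag_mx S *m (V^T *m W)))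
  (A *m P - W *m (W^T *m (A *m P))); lra.
Qed.

(** [H] is positive semidefinite, so multiplying by [1 + eta H] does not decrease norms; it is thus
    invertible with a contractive inverse. *)
Lemma resolvent eta : 0 < eta -> exists K : 'M[R]_k,
  (1%:M + eta *: H) *m K = 1%:M /\
  forall p (Y : 'M[R]_(p, k)), fsq (Y *m K) <= fsq Y.
Proof.
move=> eta0.
have expand p (Y : 'M[R]_(p, k)) : fsq Y <= fsq (Y *m (1%:M + eta *: H)).
  rewrite mulmxDr mulmx1 -scalemxAr fsqD fdotZr fsqZ.
  have -> : fdot Y (Y *m H) = fdot (W *m Y^T) (A *m (W *m Y^T)).
    rewrite fdot_mulmxl (mulmxA A) [RHS]fdot_mulmxr trmxK -mulmxA.
    by rewrite [RHS]fdotC fdot_mulmxl fdotC.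
  have := Apsd (W *m Y^T); have := fsq_ge0 (Y *m H).
  move=> a0 b0; rewrite -addrA lerDl addr_ge0 //.
    by rewrite !mulr_ge0 // ltW.
  by rewrite mulr_ge0 // sqr_ge0.
have Mu : 1%:M + eta *: H \in unitmx.
  rewrite -row_free_unit -kermx_eq0 -fsq_eq0.
  rewrite eq_le fsq_ge0 andbT; apply: le_trans (expand _ _) _.
  by rewrite mulmx_ker /fsq fdot0r.
exists (invmx (1%:M + eta *: H)); split=> [|p Y]; first exact: mulmxV.
by apply: le_trans (expand _ _) _; rewrite mulmxKV.
Qed.

(* [Z := (1 + eta H)^-1 C] is chosen so that [(W + eta A W) Z = W C + eta L Z];
   hence [V - W' Z = E - eta (L Z + N Z)] has no error term of order [eta^2]
   independent of [F]. *)
Lemma descent eta : 0 < eta -> F <= 3 / 4 -> exists Z : 'M[R]_k,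
  (forall p (Y : 'M[R]_(p, k)), fsq (Y *m Z) <= fsq Y) /\
  forall (N W1 : 'M[R]_(d, k)) (Q : 'M[R]_k),
    orthonormal W1 -> W + eta *: (A *m W + N) = W1 *m Q ->
    subspace_err W1 <= (1 - eta * lambda / 2 + 13 * eta ^+ 2 * r ^+ 2) * F
      + 2 * eta ^+ 2 * fsq N - 2 * eta * fdot E (N *m Z).
Proof.
move=> eta0 F34; have [K [HK Kcontr]] := resolvent eta0.
have F0 : 0 <= F by rewrite FE fsq_ge0.
pose Z := K *m C; have CZ p (Y : 'M[R]_(p, k)) : fsq (Y *m C) <= fsq Y.
  rewrite mulmxA; apply: le_trans (fsq_contrr _ VV) _; rewrite fsq_isomr //.
have Zcontr p (Y : 'M[R]_(p, k)) : fsq (Y *m Z) <= fsq Y.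
  by rewrite mulmxA; apply: le_trans (CZ _ _) (Kcontr _ _).
exists Z; split=> // N W1 Q W11 W1Q.
have CE : C = Z + eta *: (H *m Z).
  by rewrite -[LHS]mul1mx -HK -(mulmxA _ K) mulmxDl mul1mx -scalemxAl.
have res : V - W1 *m (Q *m Z) = E - eta *: (L *m Z + N *m Z).
  rewrite mulmxA -W1Q /L.
  have WC : W *m C = W *m Z + eta *: (W *m H *m Z).
    by rewrite CE mulmxDr -scalemxAr (mulmxA W H).
  have -> : (W + eta *: (A *m W + N)) *m Z
      = W *m Z + eta *: (A *m W *m Z + N *m Z).
    by rewrite mulmxDl -scalemxAl mulmxDl.
  have -> : (A *m W - W *m H) *m Z = A *m W *m Z - W *m H *m Z.
    by rewrite mulmxBl.
  rewrite /E WC !scalerDr scalerN !opprD !opprK !addrA.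
  by rewrite [in RHS](addrAC (V - W *m Z)) subrK.
apply: le_trans (subspace_err_min (Q *m Z) W11) _; rewrite res.
rewrite fsqB fdotZr fsqZ fdotDr -FE.
(* Replacing [Z] by [C] costs a term of order [eta]; the part [W H C] of [L C] drops out because
   [W^T E = 0]. *)
have LZ : fdot E (L *m Z) = fdot E (A *m (W *m C)) - eta * fdot E (L *m (H *m Z)).
  have ZE : Z = C - eta *: (H *m Z) by rewrite CE addrK.
  rewrite {1}ZE mulmxBr -scalemxAr fdotDr fdotNr fdotZr; congr (_ - _).
  have -> : L *m C = A *m (W *m C) - W *m (H *m C) by rewrite mulmxBl !mulmxA.
  rewrite fdotDr fdotNr [X in _ - X]fdot_mulmxl.
  by rewrite WE [fdot 0 _]fdotC fdot0r subr0.
have t1 : 2 * fdot E (L *m (H *m Z)) <= 5 * r ^+ 2 * F.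
  have r2 : 0 < r ^+ 2 by rewrite exprn_gt0.
  apply: le_trans (fdot_le _ _ r2) _; rewrite -FE.
  have : fsq (L *m (H *m Z)) <= 4 * r ^+ 2 * F * r ^+ 2.
    rewrite mulmxA; apply: le_trans (Zcontr _ _) _.
    apply: le_trans (fsqM _ _) _; rewrite ler_pM ?fsq_ge0 ?tangent_le //.
    apply: le_trans Ar; apply: le_trans (fsq_contrl _ WW) _.
    exact: fsq_contrr.
  rewrite -(ler_pM2l (x := (r ^+ 2)^-1)) ?invr_gt0 // => h.
  have e : (r ^+ 2)^-1 * (4 * r ^+ 2 * F * r ^+ 2) = 4 * r ^+ 2 * F.
    by field; rewrite gt_eqF.
  by rewrite e in h; lra.
have t2 : fsq (L *m Z + N *m Z) <= 8 * r ^+ 2 * F + 2 * fsq N.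
  apply: le_trans (fsqD_le _ _) _.
  have := tangent_le; have := Zcontr _ L; have := Zcontr _ N; lra.
(* The region [F <= 3 / 4] enters here, through [1 - F >= 1 / 4]. Doubled, this gives the rate
   [eta * lambda / 2]; the 13 is 5 from [t1] plus 8 from [t2]. *)
have t3 : lambda * F / 4 <= fdot E (A *m (W *m C)).
  apply: le_trans drift_ge; rewrite -mulrA ler_pM2l // ler_wpM2l //; lra.
have u1 : eta ^+ 2 * (2 * fdot E (L *m (H *m Z))) <= eta ^+ 2 * (5 * r ^+ 2 * F).
  by rewrite ler_wpM2l // sqr_ge0.
have u2 := ler_wpM2l (sqr_ge0 eta) t2.
have u3 := ler_wpM2l (ltW eta0) t3.
rewrite LZ; lra.
Qed.

End AtPoint.
End Descent.

(** * The stochastic step *)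

Section Alignment.
Variables (R : realType) (d k : nat).
Implicit Types W U V : 'M[R]_(d, k).

Lemma fsq_diag (S : 'rV[R]_k) : fsq (diag_mx S) = \sum_j S 0 j ^+ 2.
Proof.
rewrite fsqE; apply: eq_bigr => j _; rewrite (bigD1 j) //= big1 ?addr0.
  by rewrite mxE eqxx mulr1n.
by move=> l lj; rewrite mxE eq_sym (negPf lj) expr0n.
Qed.

(** With [B] the Procrustes rotation, the inner product of [W] and [U B] is the sum of the singular
    values of [W^T U]. These are at most 1, so the sum dominates that of their squares. *)
Lemma svd_rotation_dist W U (B : 'M[R]_k) : orthonormal W -> orthonormal U ->
  svd_rotation (W^T *m U) B ->
  fsq (W - U *m B) <= 2 * (k%:R - fsq (W^T *m U)).
Proof.
move=> WW UU [P [S [Q [[/eqP PP /eqP QQ S0 M] ->]]]].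
have PP' : orthonormal P by []. have QQ' : orthonormal Q by [].
have -> : fsq (W^T *m U) = \sum_j S 0 j ^+ 2.
  by rewrite M fsq_isomr // fsq_isoml // fsq_diag.
(* The singular value is the norm of [W^T U] applied to the unit vector [Q e_j]. *)
have S1 j : S 0 j <= 1.
  rewrite -(@ler_pXn2r _ 2) ?nnegrE // expr1n.
  pose e : 'cV[R]_k := delta_mx j 0.
  have e1 : fsq e = 1.
    rewrite fsqE (bigD1 j) //= big_ord1 mxE !eqxx expr1n big1 ?addr0 // => i ij.
    by rewrite big_ord1 mxE (negPf ij) expr0n.
  have <- : fsq (W^T *m (U *m (Q *m e))) = S 0 j ^+ 2.
    rewrite mulmxA M -!mulmxA fsq_isoml // (mulmxA Q^T) (eqP QQ) mul1mx.
    have -> : diag_mx S *m e = S 0 j *: e.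
      apply/matrixP => i l; rewrite mul_diag_mx !mxE.
      by case: eqP => [->|] //=; rewrite !mulr0.
    by rewrite fsqZ e1 mulr1.
  apply: le_trans (fsq_contrl _ WW) _.
  by rewrite fsq_isoml // fsq_isoml // e1.
rewrite fsqB fsq_orthonormal // fsq_isoml // fsq_isomr // fsq_orthonormal //.
have -> : fdot W (U *m (Q *m P^T)) = \sum_j S 0 j.
  have -> : fdot W (U *m (Q *m P^T)) = \tr (W^T *m U *m Q *m P^T).
    by rewrite /fdot !mulmxA.
  rewrite M mxtrace_mulC -!mulmxA (eqP QQ) mulmx1 mulmxA (eqP PP).
  by rewrite mul1mx mxtrace_diag.
have : \sum_j S 0 j ^+ 2 <= \sum_j S 0 j.
  by apply: ler_sum => j _; rewrite expr2 ler_piMr.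
lra.
Qed.

Lemma fsq_projB W U : orthonormal W -> orthonormal U ->
  fsq (W *m W^T - U *m U^T) = 2 * (k%:R - fsq (W^T *m U)).
Proof.
move=> WW UU; rewrite fsqB !fsq_isomr // (fsq_orthonormal WW) (fsq_orthonormal UU).
rewrite fdot_mulmxr trmxK -mulmxA fdotC fdot_mulmxl.
have -> : fdot (W^T *m U) (W^T *m U) = fsq (W^T *m U) by [].
ring.
Qed.

(** By [fsq_projB] these errors are half the squared distances between orthogonal projections, so a
    squared triangle inequality applies. *)
Lemma subspace_err_triangle V W U :
  orthonormal V -> orthonormal W -> orthonormal U ->
  k%:R - fsq (W^T *m U) <= 2 * subspace_err V W + 2 * subspace_err V U.
Proof.
move=> VV WW UU.
have := fsqB_le (V *m V^T - W *m W^T) (V *m V^T - U *m U^T).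
rewrite opprB addrC addrA subrK !fsq_projB // /subspace_err.
have -> : fsq (W^T *m U) = fsq (U^T *m W) by rewrite -fsqT trmx_mul trmxK.
lra.
Qed.
End Alignment.

Section SampleCovariance.
Variables (R : realType) (d n : nat) (X : 'M[R]_(d, n)) (r : R).
Hypotheses (n_gt0 : (0 < n)%N) (Xr : forall i, fsq (col i X) <= r).
Let A := sample_cov X.

Lemma sum_outer p (Y : 'M[R]_(d, p)) :
  \sum_i col i X *m ((col i X)^T *m Y) = n%:R *: (A *m Y).
Proof.
rewrite /A /sample_cov -scalemxAl scalerA mulfV ?pnatr_eq0 -?lt0n // scale1r.
rewrite -mulmxA; apply/matrixP => a b; rewrite summxE mxE; apply: eq_bigr => i _.
rewrite mxE big_ord1 !mxE; congr (_ * _).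
by apply: eq_bigr => l _; rewrite !mxE.
Qed.

Lemma full_gradE k (W : 'M[R]_(d, k)) : full_grad X W = A *m W.
Proof.
by rewrite /full_grad sum_outer scalerA mulVf ?scale1r // pnatr_eq0 -lt0n.
Qed.

Lemma sample_cov_sym : A^T = A.
Proof. by rewrite linearZ /= trmx_mul trmxK. Qed.

Lemma sample_cov_psd p (Y : 'M[R]_(d, p)) : 0 <= fdot Y (A *m Y).
Proof.
rewrite /A /sample_cov -scalemxAl fdotZr -mulmxA fdot_mulmxl.
by rewrite mulr_ge0 ?invr_ge0 ?ler0n // fsq_ge0.
Qed.

Lemma fsq_sample_cov : fsq A <= r ^+ 2.
Proof.
have Xn : fsq X <= n%:R * r.
  rewrite fsqE exchange_big /= -[n in n%:R]card_ord mulr_natl -sumr_const.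
  apply: ler_sum => j _; apply: le_trans (Xr j); rewrite fsqE.
  by apply: ler_sum => i _; rewrite big_ord1 mxE.
rewrite fsqZ exprVn ler_pdivrMl ?exprn_gt0 ?ltr0n // -exprMn.
apply: le_trans (fsqM _ _) _; rewrite fsqT -expr2 ler_pXn2r ?nnegrE ?fsq_ge0 //.
exact: le_trans (fsq_ge0 _) Xn.
Qed.

Lemma fsq_outer_sub i : fsq (col i X *m (col i X)^T - A) <= 4 * r ^+ 2.
Proof.
have o : fsq (col i X *m (col i X)^T) <= r ^+ 2.
  apply: le_trans (fsqM _ _) _; rewrite fsqT -expr2.
  by rewrite ler_pXn2r ?nnegrE ?fsq_ge0 // (le_trans (fsq_ge0 _) (Xr i)).
have := fsqB_le (col i X *m (col i X)^T) A; have := fsq_sample_cov; lra.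
Qed.

End SampleCovariance.

Section StochasticStep.
Variables (R : realType) (d n k : nat) (X : 'M[R]_(d, n)) (V : 'M[R]_(d, k)).
Variables (S : 'rV[R]_k) (r lambda mu eta : R).
Hypotheses (n_gt0 : (0 < n)%N) (r_gt0 : 0 < r).
Hypothesis Xr : forall i, fsq (col i X) <= r.
Let A := sample_cov X.
Hypotheses (VV : orthonormal V) (AV : A *m V = V *m diag_mx S).
Hypotheses (lambda_gt0 : 0 < lambda) (muS : forall j, mu + lambda <= S 0 j).
Hypothesis muV : forall p (Y : 'M_(d, p)), V^T *m Y = 0 ->
  fdot Y (A *m Y) <= mu * fsq Y.
Hypotheses (eta_gt0 : 0 < eta) (eta_r : eta * r <= 1 / 1024).
Hypothesis eta_lambda : eta * r ^+ 2 <= lambda / 1024.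

(** The update is [W + eta (A W + N i)] with [N i = (x_i x_i^T - A) (W - Wt B)]. This noise averages
    to 0, and the factor [W - Wt B] makes it small near convergence, which is the variance
    reduction. *)
Lemma vrpca_step_descent (W Wt : 'M[R]_(d, k)) (B : 'M[R]_k) (b : R) :
  orthonormal W -> orthonormal Wt -> svd_rotation (W^T *m Wt) B ->
  subspace_err V W <= 3 / 4 -> subspace_err V Wt <= b -> b <= 1 / 2 ->
  exists xi : 'I_n -> R, [/\ \sum_i xi i = 0,
    forall i, `|xi i| <= 21 * (eta * r) &
    forall i, orthonormal (vrpca_step X eta Wt B i W) /\
      subspace_err V (vrpca_step X eta Wt B i W) <=
        (1 - eta * lambda / 4) * subspace_err V W + 32 * (eta * r) ^+ 2 * b
        + xi i].
Proof.
move=> WW TT rotB F34 Fb b12.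
set F := subspace_err V W in F34 *.
have F0 : 0 <= F by exact: subspace_err_ge0.
pose D := W - Wt *m B.
have D4 : fsq D <= 4 * (F + b).
  have := svd_rotation_dist WW TT rotB.
  have := subspace_err_triangle VV WW TT; rewrite -/F -/D; lra.
pose N i := (col i X *m (col i X)^T - A) *m D.
have N16 i : fsq (N i) <= 16 * r ^+ 2 * (F + b).
  apply: le_trans (fsqM _ _) _.
  have -> : 16 * r ^+ 2 * (F + b) = (4 * r ^+ 2) * (4 * (F + b)) by ring.
  by rewrite ler_pM ?fsq_ge0 // fsq_outer_sub.
have N0 : \sum_i N i = 0.
  under eq_bigr do rewrite /N mulmxBl -mulmxA.
  rewrite sumrB sum_outer // sumr_const card_ord scaler_nat.
  by apply/eqP; rewrite subr_eq0.
have r2 : 0 < r ^+ 2 by rewrite exprn_gt0.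
have b0 : 0 <= b by apply: le_trans Fb; exact: subspace_err_ge0.
have [Z [Zcontr desc]] := descent (sample_cov_sym X) (sample_cov_psd X) r_gt0
  (fsq_sample_cov n_gt0 Xr) VV AV lambda_gt0 muS muV WW eta_gt0 F34.
pose E := V - W *m (W^T *m V).
(* [xi] is the term of [descent] linear in the noise; [Z] does not depend on [i], so the mean of
   [xi] is 0. *)
exists (fun i => - (2 * eta * fdot E (N i *m Z))); split.
- rewrite sumrN -mulr_sumr.
  have -> : \sum_i fdot E (N i *m Z) = fdot E ((\sum_i N i) *m Z).
    by rewrite mulmx_suml /fdot mulmx_sumr linear_sum.
  by rewrite N0 mul0mx fdot0r mulr0 oppr0.
- move=> i; rewrite normrN -mulrA mulrCA normrM (gtr0_norm eta_gt0) mulrCA.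
  rewrite ler_pM2l //.
  (* [5 / 4] bounds [F + b], and [20 = 16 * 5 / 4]. Young's inequality then gives
     [3 / 4 + 20 <= 21]. *)
  have NZ : r^-1 * fsq (N i *m Z) <= 20 * r.
    rewrite ler_pdivrMl //; apply: le_trans (Zcontr _ _) _.
    apply: le_trans (N16 i) _.
    have -> : r * (20 * r) = 16 * r ^+ 2 * (5 / 4) by field.
    rewrite ler_pM2l; [lra|by rewrite mulr_gt0].
  have EF : r * fsq E <= r * (3 / 4) by rewrite ler_pM2l // -subspace_errE.
  have up : 2 * fdot E (N i *m Z) <= 21 * r.
    apply: le_trans (fdot_le _ _ r_gt0) _; apply: le_trans (lerD EF NZ) _.
    have := r_gt0; lra.
  have lo : - (2 * fdot E (N i *m Z)) <= 21 * r.
    rewrite -mulrN -fdotNr; apply: le_trans (fdot_le _ _ r_gt0) _; rewrite fsqN.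
    apply: le_trans (lerD EF NZ) _; have := r_gt0; lra.
  by rewrite ler_norml lerNl lo up.
move=> i; pose Y := eta *: (A *m W + N i).
have stepE : vrpca_step X eta Wt B i W
    = (W + Y) *m invsqrtmx ((W + Y)^T *m (W + Y)).
  rewrite /vrpca_step full_gradE //=.
  suff -> : W + eta *: (col i X *m ((col i X)^T *m W - (col i X)^T *m Wt *m B)
     + sample_cov X *m Wt *m B) = W + Y by [].
  congr (_ + _ *: _); rewrite /N /D mulmxBl !mulmxBr !mulmxA.
  by rewrite [RHS]addrC opprB addrA subrK.
(* A perturbation this small keeps [W + Y] injective, so the normalization is well defined. The 42
   is [2 + 2 * 20]. *)
have Y1 : fsq Y < 1.
  rewrite fsqZ.
  have h : fsq (A *m W + N i) <= 42 * r ^+ 2.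
    apply: le_trans (fsqD_le _ _) _.
    have : fsq (A *m W) <= r ^+ 2.
      by apply: le_trans (fsq_contrr _ WW) _; exact: fsq_sample_cov.
    have : 16 * r ^+ 2 * (F + b) <= 16 * r ^+ 2 * (5 / 4).
      rewrite ler_pM2l; [lra|by rewrite mulr_gt0].
    have := N16 i; lra.
  apply: le_lt_trans (ler_wpM2l (sqr_ge0 _) h) _.
  have -> : eta ^+ 2 * (42 * r ^+ 2) = 42 * (eta * r) ^+ 2 by ring.
  have : (eta * r) ^+ 2 <= (1 / 1024) ^+ 2.
    by apply: lerXn2r eta_r; rewrite nnegrE ?divr_ge0 // mulr_ge0 // ltW.
  lra.
have [W1 [Q WQ]] := invsqrtmx_orthonormal
  (fun v v0 => injective_near_orthonormal WW Y1 v0).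
rewrite stepE; split=> //; apply: le_trans (desc _ _ _ W1 WQ) _.
rewrite -/E lerD2r -/F.
(* The terms in [F] of second order total [(13 + 32) (eta r)^2 F], which half of the drift absorbs;
   the rest is [32 (eta r)^2 b]. *)
have hN : 2 * eta ^+ 2 * fsq (N i) <= 2 * eta ^+ 2 * (16 * r ^+ 2 * (F + b)).
  by rewrite ler_wpM2l // mulr_ge0 // sqr_ge0.
have hF : eta * F * (eta * r ^+ 2) <= eta * F * (lambda / 1024).
  by rewrite ler_wpM2l // mulr_ge0 // ltW.
have hL : 0 <= eta * F * lambda by rewrite !mulr_ge0 // ltW.
rewrite !expr2 in hF hN *; nra.
Qed.

End StochasticStep.

(** * Mean contraction of a random iteration *)

Section Mean.
Variable R : realType.

Definition mean (I : finType) (f : I -> R) : R := (\sum_i f i) / #|I|%:R.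

Lemma uniform_probE (I : finType) (P : pred I) :
  uniform_prob R P = mean (fun i => (P i)%:R).
Proof.
congr (_ / _); rewrite -sum1_card natr_sum big_mkcond; apply: eq_bigr => i _.
by rewrite unfold_in; case: (P i).
Qed.

Lemma eq_mean (I : finType) (f g : I -> R) : f =1 g -> mean f = mean g.
Proof. by move=> fg; congr (_ / _); apply: eq_bigr => i _. Qed.

Lemma le_mean (I : finType) (f g : I -> R) :
  (forall i, f i <= g i) -> mean f <= mean g.
Proof. by move=> fg; rewrite ler_wpM2r ?invr_ge0 // ler_sum. Qed.

Lemma meanD (I : finType) (f g : I -> R) :
  mean (fun i => f i + g i) = mean f + mean g.
Proof. by rewrite /mean big_split mulrDl. Qed.

Lemma meanZ (I : finType) a (f : I -> R) :
  mean (fun i => a * f i) = a * mean f.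
Proof. by rewrite /mean -mulr_sumr mulrA. Qed.

Lemma mean_cst (I : finType) (a : R) : (0 < #|I|)%N -> mean (fun _ : I => a) = a.
Proof.
move=> I0; rewrite /mean sumr_const -[a *+ _]mulr_natr mulfK //.
by rewrite pnatr_eq0 -lt0n.
Qed.

Lemma mean_tuple0 (I : finType) (f : 0.-tuple I -> R) : mean f = f [tuple].
Proof.
rewrite /mean card_tuple expn0 divr1 (bigD1 [tuple]) //= big1 ?addr0 // => t.
by rewrite tuple0.
Qed.

(** Conditioning on the first draw. *)
Lemma mean_tupleS (I : finType) m (f : m.+1.-tuple I -> R) :
  mean f = mean (fun i => mean (fun t : m.-tuple I => f [tuple of i :: t])).
Proof.
rewrite /mean -mulr_suml -mulrA -invfM -natrM !card_tuple mulnC -expnS.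
congr (_ / _); rewrite pair_big /=.
rewrite (reindex (fun p : I * m.-tuple I => [tuple of p.1 :: p.2])) //=.
exists (fun t => (thead t, [tuple of behead t])) => [[i t] _|t _] /=.
  by congr (_, _); apply: val_inj.
by rewrite -tuple_eta.
Qed.

(** From [expR (- y) >= 1 - y] one gets [expR y <= 1 / (1 - y)]; moreover [(1 + y + 2 y^2) (1 - y) =
    1 + y^2 (1 - 2 y)]. *)
Lemma expR_le_quadratic (y : R) : `|y| <= 1 / 2 -> expR y <= 1 + y + 2 * y ^+ 2.
Proof.
rewrite ler_norml => /andP[y1 y2].
have E : expR y * expR (- y) = 1 by rewrite -expRD subrr expR0.
have h := expR_ge1Dx (- y).
have p1 : 0 < 1 - y by lra.
have p2 : expR y * (1 - y) <= 1.
  by rewrite -[leRHS]E ler_pM2l ?expR_gt0.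
rewrite -(ler_pM2r p1); apply: le_trans p2 _.
have : 0 <= y ^+ 2 * (1 - 2 * y) by rewrite mulr_ge0 ?sqr_ge0 //; lra.
rewrite !expr2; lra.
Qed.

(** A Hoeffding-type bound on the moment generating function of a centred bounded variable. *)
Lemma mean_expR_le (I : finType) (xi : I -> R) a theta :
  (0 < #|I|)%N -> mean xi = 0 -> (forall i, `|xi i| <= a) -> 0 <= theta ->
  theta * a <= 1 / 2 ->
  mean (fun i => expR (theta * xi i)) <= expR (2 * (theta * a) ^+ 2).
Proof.
move=> I0 xi0 xia th0 tha; apply: le_trans (expR_ge1Dx _).
have -> : 1 + 2 * (theta * a) ^+ 2
    = mean (fun i => (1 + 2 * (theta * a) ^+ 2) + theta * xi i).
  by rewrite meanD meanZ xi0 mulr0 addr0 mean_cst.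
apply: le_mean => i.
have bnd : `|theta * xi i| <= theta * a.
  by rewrite normrM (ger0_norm th0) ler_wpM2l.
apply: le_trans (expR_le_quadratic (le_trans bnd tha)) _.
have : (theta * xi i) ^+ 2 <= (theta * a) ^+ 2.
  rewrite -real_normK ?num_real //; apply: lerXn2r (bnd); rewrite nnegrE //.
  exact: le_trans (normr_ge0 _) bnd.
lra.
Qed.

End Mean.

Section StochasticContraction.
Variables (R : realType) (I : finType) (T : Type).
Variables (err : T -> R) (ok : pred T) (step : seq I -> T -> I -> T).
Hypothesis I_gt0 : (0 < #|I|)%N.
Hypothesis err_ge0 : forall x, ok x -> 0 <= err x.

Fixpoint run (h : seq I) (x : T) (draws : seq I) : T :=
  if draws is i :: draws' then run (rcons h i) (step h x i) draws' else x.

(** [kappa] is the fixed point of the mean recursion [e -> alpha e + (1 - alpha) kappa]. *)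
Variables alpha kappa drift noise cap : R.
Hypotheses (alpha_ge0 : 0 <= alpha) (alpha_le1 : alpha <= 1).
Hypotheses (kappa_ge0 : 0 <= kappa) (drift_ge0 : 0 <= drift).
Hypothesis kappa_drift : (1 - alpha) * kappa <= drift.
Hypothesis step_err : forall h x, ok x -> err x <= cap ->
  exists xi : I -> R, [/\ \sum_i xi i = 0, forall i, `|xi i| <= noise &
    forall i, ok (step h x i) /\
      err (step h x i) <= alpha * err x + (1 - alpha) * kappa + xi i].

(* The exponential term controls the escape from the region [err <= cap], on
   which alone the error contracts in mean; above [cap] the bound exceeds 1, so
   no stopping time is needed. *)
Definition potential (theta tau : R) (j : nat) (e : R) : R :=
  expR (theta * (e - cap))
    * expR (theta * drift + 2 * (theta * noise) ^+ 2) ^+ j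
  + (alpha ^+ j * (e - kappa) + kappa) / tau.

(** Induction on the remaining draws, conditioning on the first: the potential does not increase in
    mean, and with no draw left it dominates the failure indicator by Markov's bound
    [err x / tau]. *)
Lemma run_failure theta tau : 0 <= theta -> theta * noise <= 1 / 2 -> 0 < tau ->
  forall j h x, ok x ->
  mean (fun t : j.-tuple I =>
    (~~ (ok (run h x t) && (err (run h x t) <= tau)))%:R)
  <= potential theta tau j (err x).
Proof.
move=> th0 thn tau0.
set rho := expR (theta * drift + 2 * (theta * noise) ^+ 2).
have rho1 : 1 <= rho.
  by rewrite -expR0 ler_expR addr_ge0 // mulr_ge0 // sqr_ge0.
have lin_ge0 j x : ok x -> 0 <= (alpha ^+ j * (err x - kappa) + kappa) / tau.
  move=> okx; rewrite mulr_ge0 ?invr_ge0 ?(ltW tau0) //.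
  have aj0 : 0 <= alpha ^+ j by rewrite exprn_ge0.
  have aj1 : alpha ^+ j <= 1 by rewrite exprn_ile1.
  have -> : alpha ^+ j * (err x - kappa) + kappa
      = alpha ^+ j * err x + (1 - alpha ^+ j) * kappa by ring.
  by rewrite addr_ge0 // mulr_ge0 ?err_ge0 // subr_ge0.
elim=> [|j IHj] h x okx.
  rewrite mean_tuple0 /= okx /= -ltNge /potential expr0 !mulr1 mul1r subrK.
  case: ltP => [lt|_]; last first.
    by rewrite addr_ge0 ?expR_ge0 // divr_ge0 ?err_ge0 // ltW.
  apply: le_trans (_ : err x / tau <= _); last by rewrite lerDr expR_ge0.
  by rewrite ler_pdivlMr // mul1r ltW.
have [e_le|e_gt] := leP (err x) cap; last first.
  apply: le_trans (_ : mean (fun _ : j.+1.-tuple I => 1) <= _).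
    by apply: le_mean => t; case: (~~ _).
  rewrite mean_cst ?card_tuple ?expn_gt0 ?I_gt0 //.
  apply: le_trans (_ : expR (theta * (err x - cap)) * rho ^+ j.+1 <= _).
    rewrite -[leLHS]mulr1 ler_pM //; last by rewrite exprn_ege1.
    by rewrite -expR0 ler_expR mulr_ge0 // subr_ge0 ltW.
  by rewrite lerDl lin_ge0.
have [xi [xi0 xin xistep]] := step_err h okx e_le.
rewrite mean_tupleS.
apply: le_trans (_ : mean (fun i => potential theta tau j (err (step h x i))) <= _).
  by apply: le_mean => i; apply: IHj; exact: (xistep i).1.
have mxi : mean xi = 0 by rewrite /mean xi0 mul0r.
rewrite /potential meanD -/rho; apply: lerD.
  (* Below [cap] the error grows by at most [drift + xi i], so the mean of the exponential part
     grows by a factor at most [rho]. *)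
  apply: le_trans (_ : mean (fun i =>
    expR (theta * (err x - cap)) * expR (theta * drift) * rho ^+ j
      * expR (theta * xi i)) <= _).
    apply: le_mean => i; rewrite mulrAC ler_wpM2r ?exprn_ge0 ?expR_ge0 //.
    rewrite -!expRD ler_expR -!mulrDr ler_wpM2l //.
    have := (xistep i).2; have : alpha * err x <= err x.
      by rewrite ler_piMl // err_ge0.
    have := kappa_drift; lra.
  rewrite meanZ exprSr -/rho.
  have := mean_expR_le I_gt0 mxi xin th0 thn => hm.
  apply: le_trans (ler_wpM2l _ hm) _.
    by rewrite !mulr_ge0 ?exprn_ge0 ?expR_ge0.
  by rewrite /rho expRD le_eqVlt; apply/orP; left; apply/eqP; ring.
pose a := alpha ^+ j.
apply: le_trans (_ : mean (fun i => (a * (alpha * (err x - kappa)) + kappa) / tau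
    + a / tau * xi i) <= _).
  apply: le_mean => i.
  have a0 : 0 <= a by rewrite exprn_ge0.
  have h1 : a * (err (step h x i) - kappa) + kappa
      <= (a * (alpha * (err x - kappa)) + kappa) + a * xi i.
    have := ler_wpM2l a0 (xistep i).2; lra.
  have := ler_wpM2r (_ : 0 <= tau^-1) h1; rewrite invr_ge0 => /(_ (ltW tau0)).
  move/le_trans; apply; rewrite mulrDl mulrAC lexx //.
by rewrite meanD mean_cst // meanZ mxi mulr0 addr0 exprSr -/a mulrA.
Qed.

End StochasticContraction.

(** * Epochs *)

Section EpochConstants.
Variables (R : realType) (r lambda eta delta : R) (m : nat).
Hypotheses (r_gt0 : 0 < r) (lambda_gt0 : 0 < lambda) (lambda_r : lambda <= r).
Hypotheses (eta_gt0 : 0 < eta) (delta_gt0 : 0 < delta) (delta_lt1 : delta < 1).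
Let ell := ln (2 / delta).
Hypothesis eta_le : eta * r ^+ 2 <= delta ^+ 2 * lambda / 1024.
Hypothesis m_ge : 12 * ell <= m%:R * (eta * lambda).
Hypothesis m_le : m%:R * (eta * r) ^+ 2 <= 1 / 1024.
Hypothesis m_ln_le : ell * (m%:R * (eta * r) ^+ 2) <= (1 / 1024) ^+ 2.

Lemma ln_2div_gt0 : 0 < ell.
Proof.
by rewrite ln_gt0 // ltr_pdivlMr // mul1r (lt_trans delta_lt1) // ltr1n.
Qed.

Lemma expR_ell : expR (- ell) = delta / 2.
Proof. by rewrite expRN lnK ?posrE ?divr_gt0 // invf_div. Qed.

Lemma eta_r_le : eta * r <= delta ^+ 2 / 1024.
Proof.
rewrite -(ler_pM2r r_gt0) -mulrA -expr2; apply: le_trans eta_le _.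
have : delta ^+ 2 * lambda <= delta ^+ 2 * r by rewrite ler_wpM2l // sqr_ge0.
lra.
Qed.

Lemma delta_sqr_le : delta ^+ 2 <= delta.
Proof. by rewrite expr2 ler_piMr // ltW. Qed.

(** The side condition of [run_failure] at [theta = 8 * ell]. The bound [ell <= 2 / delta] is
    absorbed by the factor [delta ^+ 2] in the step size. *)
Lemma noise_le : 8 * ell * (21 * (eta * r)) <= 1 / 2.
Proof.
have h1 : ell <= 2 / delta by rewrite ltW // ln_sublinear // divr_gt0.
have h2 : ell * (eta * r) <= 2 / delta * (delta ^+ 2 / 1024).
  by rewrite ler_pM ?eta_r_le // ltW // ?ln_2div_gt0 // mulr_gt0.
have e : 2 / delta * (delta ^+ 2 / 1024) = delta / 512.
  by field; rewrite gt_eqF.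
rewrite e in h2; have := delta_lt1; lra.
Qed.

(** The escape term and the Markov term each cost [delta / 2]. Here [kappa] is the additive error
    [32 (eta r)^2 b] divided by the rate [eta lambda / 4]. *)
Lemma epoch_potential_le b e : 0 < b -> e <= b -> b <= 1 / 2 ->
  potential (1 - eta * lambda / 4) (128 * (eta * r ^+ 2) / lambda * b)
    (16 * (eta * r) ^+ 2) (21 * (eta * r)) (3 / 4) (8 * ell) (delta / 2 * b) m e
  <= delta.
Proof.
move=> b0 eb b12; have l0 := ln_2div_gt0.
have mx := m_le; have mlx := m_ln_le; have r2_le := eta_le.
set x := eta * r in mx mlx *; set kappa := _ / lambda * b.
have el4 : eta * lambda <= 1.
  have : eta * lambda <= eta * r by rewrite ler_pM2l.
  have := eta_r_le; have := delta_sqr_le; have := delta_lt1; lra.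
have al0 : 0 <= 1 - eta * lambda / 4 by lra.
have d0 : 0 < delta / 2 by rewrite divr_gt0.
rewrite /potential.
have part1 : expR (8 * ell * (e - 3 / 4))
    * expR (8 * ell * (16 * x ^+ 2) + 2 * (8 * ell * (21 * x)) ^+ 2) ^+ m
    <= delta / 2.
  rewrite -expRM_natl -expRD -expR_ell ler_expR.
  (* Starting at most at [1 / 2], the error is [1 / 4] below the cap, worth [-2 ell] in the
     exponent; the growth over [m] steps gives back at most [ell]. *)
  have t1 : 8 * ell * (e - 3 / 4) <= - (2 * ell).
    have -> : - (2 * ell) = 8 * ell * (- (1 / 4)) by field.
    rewrite ler_pM2l; [lra|by rewrite mulr_gt0].
  have -> : m%:R * (8 * ell * (16 * x ^+ 2) + 2 * (8 * ell * (21 * x)) ^+ 2)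
     = ell * (128 * (m%:R * x ^+ 2) + 2 * (168 * 168) * (ell * (m%:R * x ^+ 2))).
    by ring.
  have t2 : ell * (128 * (m%:R * x ^+ 2) + 2 * (168 * 168) * (ell * (m%:R * x ^+ 2)))
    <= ell * 1.
    rewrite ler_pM2l //; move: mx mlx; rewrite !expr2; lra.
  lra.
(* The constant 12 in [m_ge] makes [m * eta * lambda / 4] at least [3 * ell]. *)
have part2 : (1 - eta * lambda / 4) ^+ m <= (delta / 2) ^+ 3.
  apply: le_trans (_ : expR (- (eta * lambda / 4)) ^+ m <= _).
    by apply: lerXn2r (expR_ge1Dx _); rewrite nnegrE // ltW // expR_gt0.
  rewrite -expR_ell -!expRM_natl ler_expR; have := m_ge; lra.
have kb : kappa <= delta ^+ 2 / 8 * b.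
  rewrite ler_pM2r // ler_pdivrMr //; move: eta_le; lra.
(* Both the contracted start and [kappa] are at most [delta ^+ 2 / 8 * b]; together they make
   [delta / 2] times the target [delta / 2 * b]. *)
have part3 : ((1 - eta * lambda / 4) ^+ m * (e - kappa) + kappa)
    / (delta / 2 * b) <= delta / 2.
  have k0 : 0 <= kappa.
    by rewrite !mulr_ge0 ?invr_ge0 ?sqr_ge0 // ltW.
  rewrite ler_pdivrMr; last exact: mulr_gt0.
  have h1 : (1 - eta * lambda / 4) ^+ m * (e - kappa) <= (delta / 2) ^+ 3 * b.
    apply: le_trans (_ : (1 - eta * lambda / 4) ^+ m * b <= _).
      by rewrite ler_wpM2l ?exprn_ge0 //; lra.
    by rewrite ler_pM2r.
  have h2 : (delta / 2) ^+ 3 * b <= delta ^+ 2 / 8 * b.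
    rewrite ler_pM2r //.
    have -> : (delta / 2) ^+ 3 = delta ^+ 2 / 8 * delta by field.
    by rewrite ler_piMr ?divr_ge0 ?sqr_ge0 // ltW.
  lra.
lra.
Qed.

End EpochConstants.

Section Epochs.
Variables (R : realType) (d n k m : nat) (X : 'M[R]_(d, n)) (V : 'M[R]_(d, k)).
Variables (S : 'rV[R]_k) (r lambda mu eta delta : R).
Variable rot : seq 'I_n -> 'M[R]_k -> 'M[R]_k.
Hypothesis rot_svd : forall h M, svd_rotation M (rot h M).
Hypotheses (n_gt0 : (0 < n)%N) (r_gt0 : 0 < r).
Hypothesis Xr : forall i, fsq (col i X) <= r.
Hypotheses (VV : orthonormal V) (AV : sample_cov X *m V = V *m diag_mx S).
Hypotheses (lambda_gt0 : 0 < lambda) (lambda_r : lambda <= r).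
Hypothesis muS : forall j, mu + lambda <= S 0 j.
Hypothesis muV : forall p (Y : 'M_(d, p)), V^T *m Y = 0 ->
  fdot Y (sample_cov X *m Y) <= mu * fsq Y.
Hypotheses (eta_gt0 : 0 < eta) (delta_gt0 : 0 < delta) (delta_lt1 : delta < 1).
Hypothesis eta_le : eta * r ^+ 2 <= delta ^+ 2 * lambda / 1024.
Hypothesis m_ge : 12 * ln (2 / delta) <= m%:R * (eta * lambda).
Hypothesis m_le : m%:R * (eta * r) ^+ 2 <= 1 / 1024.
Hypothesis m_ln_le :
  ln (2 / delta) * (m%:R * (eta * r) ^+ 2) <= (1 / 1024) ^+ 2.

Lemma vrpca_innerE (Wt : 'M[R]_(d, k)) h W draws :
  vrpca_inner X eta rot Wt h W draws =
  run (fun h W i => vrpca_step X eta Wt (rot h (W^T *m Wt)) i W) h W draws.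
Proof. by elim: draws h W => //= i draws IH h W; rewrite IH. Qed.

Lemma epoch_failure h (Wt : 'M[R]_(d, k)) b :
  orthonormal Wt -> subspace_err V Wt <= b -> 0 < b -> b <= 1 / 2 ->
  mean (fun e : m.-tuple 'I_n =>
    (~~ (orthonormal (vrpca_epoch X eta rot h Wt e) &&
         (subspace_err V (vrpca_epoch X eta rot h Wt e) <= delta / 2 * b)))%:R)
  <= delta.
Proof.
move=> TT Tb b0 b12.
have x_le := eta_r_le r_gt0 lambda_r eta_le.
have d2 := delta_sqr_le delta_gt0 delta_lt1.
have el1 : eta * lambda <= 1.
  have : eta * lambda <= eta * r by rewrite ler_pM2l.
  have := delta_lt1; lra.
have el0 : 0 < eta * lambda by rewrite mulr_gt0.
have er0 : 0 < eta * r by rewrite mulr_gt0.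
have l0 := ln_2div_gt0 delta_gt0 delta_lt1.
under eq_mean do rewrite /vrpca_epoch vrpca_innerE.
apply: le_trans (epoch_potential_le r_gt0 lambda_gt0 lambda_r eta_gt0 delta_gt0
  delta_lt1 eta_le m_ge m_le m_ln_le b0 Tb b12).
apply: run_failure => //.
- by rewrite card_ord.
- by move=> W; exact: subspace_err_ge0.
- lra.
- lra.
- by rewrite !mulr_ge0 ?invr_ge0 ?sqr_ge0 // ltW.
- by rewrite mulr_ge0 // sqr_ge0.
- have -> : (1 - (1 - eta * lambda / 4))
      * (128 * (eta * r ^+ 2) / lambda * b) = 32 * (eta * r) ^+ 2 * b.
    by field; rewrite gt_eqF.
  have : 32 * (eta * r) ^+ 2 * b <= 32 * (eta * r) ^+ 2 * (1 / 2).
    by rewrite ler_wpM2l // mulr_ge0 // sqr_ge0.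
  lra.
- move=> g W WW WF.
  have x1024 : eta * r <= 1 / 1024 by have := delta_lt1; lra.
  have el1024 : eta * r ^+ 2 <= lambda / 1024.
    apply: le_trans eta_le _; rewrite ler_pM2r ?invr_gt0 //.
    by rewrite ler_piMl ?(ltW lambda_gt0) // (le_trans d2) // ltW.
  have [xi [xi0 xib xiF]] := vrpca_step_descent n_gt0 r_gt0 Xr VV AV lambda_gt0
    muS muV eta_gt0 x1024 el1024 WW TT (rot_svd g _) WF Tb b12.
  exists xi; split=> // i; have [W1 W1F] := xiF i; split=> //.
  apply: le_trans W1F _; rewrite lerD2r lerD2l.
  by rewrite le_eqVlt; apply/orP; left; apply/eqP; field; rewrite gt_eqF.
- by rewrite mulr_ge0 // ltW.
- exact: noise_le r_gt0 lambda_r eta_gt0 delta_gt0 delta_lt1 eta_le.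
- by rewrite mulr_gt0 // divr_gt0.
Qed.

(** Union bound by induction: condition on the first epoch and, if it succeeds, restart from the
    extended history with [delta / 2 * b] in place of [b]. *)
Lemma epochs_failure T h (Wt : 'M[R]_(d, k)) b :
  orthonormal Wt -> subspace_err V Wt <= b -> 0 < b -> b <= 1 / 2 ->
  mean (fun w : T.-tuple (m.-tuple 'I_n) =>
    (~~ (subspace_err V (vrpca_from X eta rot h Wt w) <= (delta / 2) ^+ T * b))%:R)
  <= T%:R * delta.
Proof.
elim: T h Wt b => [|T IHT] h Wt b TT Tb b0 b12.
  by rewrite mean_tuple0 /= expr0 mul1r Tb mul0r.
have d0 : 0 < delta / 2 by rewrite divr_gt0.
rewrite mean_tupleS.
have T_ge0 : 0 <= T%:R * delta by rewrite mulr_ge0 // ltW.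
pose good e := orthonormal (vrpca_epoch X eta rot h Wt e) &&
  (subspace_err V (vrpca_epoch X eta rot h Wt e) <= delta / 2 * b).
have card_gt0 (p : nat) : (0 < #|{: p.-tuple 'I_n}|)%N.
  by rewrite card_tuple card_ord expn_gt0 n_gt0.
have cardT_gt0 (p : nat) : (0 < #|{: p.-tuple (m.-tuple 'I_n)}|)%N.
  by rewrite card_tuple expn_gt0 card_gt0.
apply: le_trans (_ : mean (fun e : m.-tuple 'I_n =>
  (~~ good e)%:R + T%:R * delta) <= _); last first.
  rewrite meanD mean_cst // -natr1 mulrDl mul1r addrC lerD2l.
  exact: epoch_failure.
apply: le_mean => e; case: (boolP (good e)) => [/andP[eO eF]|_] /=.
  rewrite add0r exprSr.
  under eq_mean do rewrite -mulrA.
  apply: IHT => //; first by rewrite mulr_gt0.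
  have : delta / 2 * b <= 1 * b by rewrite ler_pM2r //; have := delta_lt1; lra.
  lra.
apply: le_trans (_ : mean (fun _ : T.-tuple (m.-tuple 'I_n) => 1) <= _).
  by apply: le_mean => w; case: (~~ _).
by rewrite mean_cst // lerDl.
Qed.

End Epochs.

(** * Bound on the eigengap and conclusion *)

Lemma frobenius_sqr (R : realType) p q (M : 'M[R]_(p, q)) :
  frobenius M ^+ 2 = fsq M.
Proof.
rewrite /frobenius sqr_sqrtr -fsqE //; exact: fsq_ge0.
Qed.

Lemma rayleigh_le (R : realType) d (A : 'M[R]_d) r (v : 'cV[R]_d) :
  0 < r -> fsq A <= r ^+ 2 -> fdot v (A *m v) <= r * fsq v.
Proof.
move=> r0 Ar; have := fdot_le v (A *m v) r0.
have : r^-1 * fsq (A *m v) <= r * fsq v.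
  rewrite ler_pdivrMl //; apply: le_trans (fsqM _ _) _.
  by rewrite mulrA -expr2 ler_wpM2r // fsq_ge0.
lra.
Qed.

(** [s k] is an eigenvalue of a positive semidefinite matrix, hence nonnegative, and [s k.-1] is the
    Rayleigh quotient of a unit column of [V], hence at most [r]. *)
Lemma eigengap_le (R : realType) d k (A : 'M[R]_d) (s : nat -> R)
    (V : 'M[R]_(d, k)) r :
  (0 < k < d)%N -> ordered_eigenvalues A s -> leading_eigenvectors A s V ->
  (forall p (Y : 'M[R]_(d, p)), 0 <= fdot Y (A *m Y)) -> A^T = A ->
  0 < r -> fsq A <= r ^+ 2 -> s k.-1 - s k <= r.
Proof.
case/andP=> k0 kd [cpA _] [VV AV] Apsd Asym r0 Ar.
have sk_ge0 : 0 <= s k.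
  have /eigenvalueP[v vA v0] : eigenvalue A (s k).
    rewrite eigenvalue_root_char cpA (bigD1 (Ordinal kd)) //= rootM.
    by rewrite root_XsubC eqxx.
  have := Apsd _ v^T; rewrite -{1}Asym -trmx_mul vA linearZ /= fdotZr.
  by rewrite pmulr_lge0 // -/(fsq _) fsqT fsq_gt0.
have sk_le : s k.-1 <= r.
  have kk : (k.-1 < k)%N by rewrite prednK.
  pose j := Ordinal kk; have := rayleigh_le (col j V) r0 Ar.
  have -> : A *m col j V = s k.-1 *: col j V by exact: AV j.
  suff v1 : fsq (col j V) = 1 by rewrite fdotZr -/(fsq _) v1 !mulr1.
  have -> : fsq (col j V) = (V^T *m V) j j.
    by rewrite fsqE mxE; apply: eq_bigr => i _; rewrite big_ord1 !mxE expr2.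
  by rewrite VV mxE eqxx.
lra.
Qed.

Theorem theorem1 (R : realType) :
  exists c c' c'' : R, [/\ 0 < c, 0 < c' & 0 < c''] /\
  forall (d n k : nat) (X : 'M[R]_(d, n)) (s : nat -> R)
    (Vk W0 : 'M[R]_(d, k)) (r lambda delta eps eta : R) (m T : nat)
    (rot : seq 'I_n -> 'M[R]_k -> 'M[R]_k),
  (0 < n)%N ->
  (0 < k < d)%N ->
  ordered_eigenvalues (sample_cov X) s ->
  leading_eigenvectors (sample_cov X) s Vk ->
  W0^T *m W0 = 1%:M ->
  0 < r ->
  (forall i : 'I_n, frobenius (col i X) ^+ 2 <= r) ->
  s 1%N < s 0%N ->
  0 < lambda ->
  s k.-1 - s k = lambda ->
  k%:R - frobenius (Vk^T *m W0) ^+ 2 <= 1 / 2 ->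
  0 < delta < 1 ->
  0 < eps < 1 ->
  (0 < m)%N ->
  0 < eta ->
  eta <= c * delta ^+ 2 / r ^+ 2 * lambda ->
  c' * ln (2 / delta) / (eta * lambda) <= m%:R ->
  k%:R * m%:R * eta ^+ 2 * r ^+ 2
    + r * k%:R * Num.sqrt (m%:R * eta ^+ 2 * ln (2 / delta)) <= c'' ->
  T%:Z = Num.ceil (ln (1 / eps) / ln (2 / delta)) ->
  (forall h M, svd_rotation M (rot h M)) ->
  1 - (Num.ceil (ln (1 / eps) / ln 2))%:~R * delta <=
  uniform_prob R [pred w : T.-tuple (m.-tuple 'I_n) |
    k%:R - frobenius (Vk^T *m vrpca X eta rot W0 w) ^+ 2 <= eps].
Proof.
exists (1 / 1024), 12, (1 / 1024); split; first by rewrite divr_gt0 // ltr0n.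
move=> d n k X s Vk W0 r lambda delta eps eta m T rot n0 kd As AV W00 r0 Xr _.
move=> lam0 gap W0F /andP[d0 d1] /andP[e0 e1] m0 eta0 etaB mB smallB TE rotP.
have Xr' i : fsq (col i X) <= r by rewrite -frobenius_sqr.
have Asym := sample_cov_sym X.
have Apsd := sample_cov_psd X.
have Ar := fsq_sample_cov n0 Xr'.
have gap_lt : s k < s k.-1 by rewrite -subr_gt0 gap.
have lam_r : lambda <= r.
  by rewrite -gap; exact: eigengap_le kd As AV Apsd Asym r0 Ar.
have [/eqP VV _] := AV.
have AVE := leading_eigenvectorsE AV.
have muS (j : 'I_k) : s k + lambda <= (\row_(j < k) s j) 0 j.
  rewrite mxE -gap addrC subrK; have [_ sd] := As; case/andP: kd => k0 kd.
  apply: sd; rewrite (leq_ltn_trans (leq_pred _) kd) andbT.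
  by rewrite -ltnS prednK.
have muV := complement_eigenvalue_le Asym kd As AV gap_lt.
have l0 := ln_2div_gt0 d0 d1.
set ell := ln (2 / delta) in mB smallB TE l0.
have eta_le : eta * r ^+ 2 <= delta ^+ 2 * lambda / 1024.
  have r2 : 0 < r ^+ 2 by rewrite exprn_gt0.
  rewrite -ler_pdivlMr //; apply: le_trans etaB _.
  by rewrite le_eqVlt; apply/orP; left; apply/eqP; field; rewrite gt_eqF.
have m_ge : 12 * ell <= m%:R * (eta * lambda).
  by rewrite -ler_pdivrMr // mulr_gt0.
have k1 : 1 <= k%:R :> R by rewrite ler1n; case/andP: kd.
have q0 : 0 <= m%:R * (eta * r) ^+ 2 by rewrite mulr_ge0 ?sqr_ge0.
have sq0 : 0 <= r * Num.sqrt (m%:R * eta ^+ 2 * ell).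
  by rewrite mulr_ge0 ?sqrtr_ge0 // ltW.
(* This and [m_ln_le] each keep one summand of the smallness condition, using [1 <= k]; the second
   is then squared. *)
have m_le : m%:R * (eta * r) ^+ 2 <= 1 / 1024.
  apply: le_trans smallB; apply: le_trans (_ : k%:R * (m%:R * (eta * r) ^+ 2) <= _).
    by rewrite ler_peMl.
  have := mulr_ge0 (ler0n R k) sq0; lra.
have m_ln_le : ell * (m%:R * (eta * r) ^+ 2) <= (1 / 1024) ^+ 2.
  have h : r * Num.sqrt (m%:R * eta ^+ 2 * ell) <= 1 / 1024.
    apply: le_trans smallB.
    apply: le_trans (_ : k%:R * (r * Num.sqrt (m%:R * eta ^+ 2 * ell)) <= _).
      by rewrite ler_peMl.
    have := mulr_ge0 (ler0n R k) q0; lra.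
  have -> : ell * (m%:R * (eta * r) ^+ 2)
      = (r * Num.sqrt (m%:R * eta ^+ 2 * ell)) ^+ 2.
    rewrite [RHS]exprMn sqr_sqrtr; first by ring.
    by rewrite !mulr_ge0 ?sqr_ge0 // ltW.
  by apply: lerXn2r h; rewrite nnegrE // divr_ge0.
have half0 : 0 < 1 / 2 :> R by rewrite divr_gt0.
have W0b : subspace_err Vk W0 <= 1 / 2 by rewrite /subspace_err -frobenius_sqr.
have W0o : orthonormal W0 by exact/eqP.
have fail := epochs_failure rotP n0 r0 Xr' VV AVE lam0 lam_r muS muV
  eta0 d0 d1 eta_le m_ge m_le m_ln_le T [::] W0o W0b half0 (lexx _).
have T_ge : ln (1 / eps) <= ell * T%:R.
  by rewrite [leRHS]mulrC -ler_pdivrMr // (le_trans (ceil_ge _)) // -TE.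
have lne0 : 0 <= ln (1 / eps).
  by rewrite ln_ge0 // ler_pdivlMr // mul1r ltW.
have ln2_gt0 : 0 < ln 2 :> R by rewrite ln_gt0 // ltr1n.
(* [2 / delta >= 2], so the number of epochs is at most the ceiling of the base 2 logarithm. *)
have T_le : T%:R * delta <= (Num.ceil (ln (1 / eps) / ln 2))%:~R * delta.
  rewrite ler_pM2r //.
  have -> : T%:R = T%:Z%:~R :> R by [].
  rewrite ler_int TE; apply: le_ceil; rewrite ler_wpM2l // lef_pV2 ?posrE //.
  by rewrite ler_ln ?posrE ?divr_gt0 // ler_pdivlMr //; lra.
(* [(delta / 2) ^+ T = expR (- ell * T)], and [T] is at least [ln (1 / eps) / ell]. *)
have tgt : (delta / 2) ^+ T * (1 / 2) <= eps.
  have : (delta / 2) ^+ T <= eps.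
    rewrite -(expR_ell d0) -expRM_natl mulrN.
    have -> : eps = expR (- ln (1 / eps)).
      by rewrite expRN lnK ?posrE ?divr_gt0 // invf_div divr1.
    by rewrite ler_expR lerN2 [leRHS]mulrC.
  lra.
rewrite uniform_probE.
apply: le_trans (_ : 1 - T%:R * delta <= _); first by rewrite lerD2l lerN2.
rewrite lerBlDr -lerBlDl; apply: le_trans fail.
rewrite lerBlDl -meanD.
apply: le_trans (_ : mean (fun _ : T.-tuple (m.-tuple 'I_n) => 1) <= _).
  by rewrite mean_cst // !card_tuple card_ord !expn_gt0 n0.
apply: le_mean => w; rewrite -natrD ler1n /= frobenius_sqr.
rewrite -/(subspace_err Vk _) -/(vrpca X eta rot W0 w).
case: (leP _ ((delta / 2) ^+ T * (1 / 2))) => [h|_]; last by rewrite addnC.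
by rewrite (le_trans h tgt).
Qed.
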